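(* Maintaining strong components via soft-threshold search takes $\mathrm{O}(m^{3/2})$ total time over $m$ arc additions: worst-case if each new threshold $s$ is always a median (or an approximate median) of the set of choices, and in expectation if each new $s$ is chosen uniformly at random from the set of choices.
   Context: Incremental setting: $n$ fixed vertices, initially no arcs; $m=\Omega(n)$ distinct arcs added one at a time. Goal: maintain the partition into strongly connected components, each with a canonical vertex; $f(x)$ denotes the canonical vertex of $x$'s component (disjoint-set structure with path compression and union by rank; treat each find/unite as $\mathrm{O}(1)$ amortized); and a list of canonical vertices in a topological order of the components, kept in a dynamic ordered list with $\mathrm{O}(1)$ amortized order queries, insertions and deletions. For each canonical vertex $x$ keep a circular doubly linked outgoing list of all arcs $(y,z)$ with $f(y)=x$ and incoming list of all arcs $(y,z)$ with $f(z)=x$; merging components concatenates these lists. Adding arc $(v,w)$: insert it in the lists; if $f(v)<f(w)$ stop. If $f(v)>f(w)$, run soft-threshold search from $f(w)$ (forward) and $f(v)$ (backward) on canonical vertices: $F=\{f(w)\}$, $B=\{f(v)\}$, $\mathit{out}(f(w))$, $\mathit{in}(f(v))$ = first arcs on the respective lists (null if empty), $s=f(v)$, $F_A=\{f(w)\}$ or $\{\}$ (if $\mathit{out}$ null), $B_A$ likewise, $F_P=B_P=\{\}$. While $F_A\ne\{\}$ and $B_A\ne\{\}$: choose any $u\in F_A$, $z\in B_A$. If $u<z$: let $(q,g)=\mathit{out}(u)$, $(h,r)=\mathit{in}(z)$, advance both pointers to the next arcs on their circular lists; $x=f(g)$, and if $\mathit{out}(u)$ returned to the first arc of $u$'s list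 remove $u$ from $F_A$; $y=f(h)$, and if $\mathit{in}(z)$ returned to the first arc of $z$'s list remove $z$ from $B_A$; if $u=x$ delete arc $(q,g)$ (a loop); if $y=z$ delete $(h,r)$; if $x\notin F$, add $x$ to $F$, set $\mathit{out}(x)$ to its first outgoing arc and add $x$ to $F_A$ if non-null; if $y\notin B$, symmetrically. (A component may be in both $F$ and $B$; no cycle test is made.) Otherwise: if $u>s$ move $u$ from $F_A$ to $F_P$; if $z<s$ move $z$ from $B_A$ to $B_P$. Then if $F_A=\{\}$: $B_P=\{\}$, remove $s$ from $B_A$, and if $F_P\ne\{\}$ choose new $s\in F_P$ and move all $x\in F_P$, $x\le s$, to $F_A$. If $B_A=\{\}$: $F_P=\{\}$, remove $s$ from $F_A$, and if $B_P\ne\{\}$ choose new $s\in B_P$ and move all $x\in B_P$, $x\ge s$, to $B_A$. After the search: $t=\min(\{f(v)\}\cup\{x\in F:\mathit{out}(x)\ne\text{null}\})$, $F_<=\{x\in F:x<t\}$, $B_>=\{y\in B:y>t\}$. Find the new component, if any, by a linear-time static strong-components computation on the graph with vertex set $X=F_<\cup\{t\}\cup B_>$ and arc set $Y$ consisting of $(f(u),f(x))$ for arcs $(u,x)$ with $f(u)\in F_<$, $f(u)\ne f(x)$, and $(f(y),f(z))$ for arcs $(y,z)$ with $f(z)\in B_>$, $f(y)\ne f(z)$; combine its old components into one with canonical vertex $f(v)$. Reorder: if $t=f(v)$ move $F_<$ just after $t$, else move $F_<$ just before $t$ and $B_>$ just before $F_<$, each internally in topological order; then delete from the list the vertices that are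 no longer canonical.
   Formalization: The pair u = z = s, on which the loop body does nothing (so the search could run forever), is not an allowed choice and the loop ends if it is the only pair; the arc (f(v), f(w)) is added to Y, without which no new component would ever be found. *)

(* Defs.v *)
From mathcomp Require Import all_boot all_order all_algebra.
Import GRing.Theory Num.Theory.

Set Implicit Arguments.
Unset Strict Implicit.
Unset Printing Implicit Defensive.

(* Vertices are the elements of 'I_n; the arc (y, z) goes from y to z. *)
Definition darc (n : nat) : Type := ('I_n * 'I_n)%type.

(** * The data structure *)

(* [outs x] and [ins x] are meaningful only for canonical x.  A circular list
   is represented by the sequence of its arcs read from its first arc. *)
Record state (n : nat) := State {
  rep : 'I_n -> 'I_n;
  toporder : seq 'I_n;
  outs : 'I_n -> seq (darc n);
  ins : 'I_n -> seq (darc n)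
}.

Section Algorithm.
Variable n : nat.
Implicit Types (G : state n) (a : darc n) (x y u z s : 'I_n).

Definition init_state (o : seq 'I_n) : state n :=
  State id o (fun _ => [::]) (fun _ => [::]).

Definition before G x y : bool := index x (toporder G) < index y (toporder G).
Definition before_eq G x y : bool := index x (toporder G) <= index y (toporder G).

Definition insert_at (i : nat) a (l : seq (darc n)) : seq (darc n) :=
  take i l ++ a :: drop i l.

Definition insert_arc G a (i j : nat) : state n :=
  let v := rep G a.1 in
  let w := rep G a.2 in
  State (rep G) (toporder G)
    [eta outs G with v |-> insert_at i a (outs G v)]
    [eta ins G with w |-> insert_at j a (ins G w)].

Definition delete_loop G x a : state n :=
  State (rep G) (toporder G)
    [eta outs G with x |-> rem a (outs G x)]
    [eta ins G with x |-> rem a (ins G x)].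

(** * The soft-threshold search *)

(* A pointer into a circular list is represented by the sequence of the arcs
   that it has still to visit: the arc it points to comes first, and [::] is
   the null pointer of an exhausted (or empty) list.  The deletion of a loop
   during a search changes the lists but not the pointers already set: a loop
   that was found by the search in one direction may still be visited by the
   search in the other direction, where its second deletion has no effect. *)
Record search := Search {
  fwd : {set 'I_n};
  bwd : {set 'I_n};
  outp : 'I_n -> seq (darc n);
  inp : 'I_n -> seq (darc n);
  factive : {set 'I_n};
  fpassive : {set 'I_n};
  bactive : {set 'I_n};
  bpassive : {set 'I_n};
  thr : 'I_n
}.
Implicit Types (S : search).

Definition is_null (l : seq (darc n)) : bool := nilp l.

Definition init_search G a : search :=
  let v := rep G a.1 in
  let w := rep G a.2 in
  Search [set w] [set v]
    [eta (fun _ => [::]) with w |-> outs G w]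
    [eta (fun _ => [::]) with v |-> ins G v]
    (if is_null (outs G w) then set0 else [set w]) set0
    (if is_null (ins G v) then set0 else [set v]) set0
    v.

Definition visit_fwd G S x : search :=
  if x \in fwd S then S else
  Search (x |: fwd S) (bwd S)
    [eta outp S with x |-> outs G x] (inp S)
    (if is_null (outs G x) then factive S else x |: factive S) (fpassive S)
    (bactive S) (bpassive S) (thr S).

Definition visit_bwd G S y : search :=
  if y \in bwd S then S else
  Search (fwd S) (y |: bwd S)
    (outp S) [eta inp S with y |-> ins G y]
    (factive S) (fpassive S)
    (if is_null (ins G y) then bactive S else y |: bactive S) (bpassive S)
    (thr S).

Definition advance S u (lo : seq (darc n)) z (li : seq (darc n)) : search :=
  Search (fwd S) (bwd S)
    [eta outp S with u |-> lo] [eta inp S with z |-> li]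
    (if is_null lo then factive S :\ u else factive S) (fpassive S)
    (if is_null li then bactive S :\ z else bactive S) (bpassive S)
    (thr S).

(* Active vertices have non-null pointers, so the default case of the match
   does not occur. *)
Definition search_step G S u z : state n * search :=
  match outp S u, inp S z with
  | a :: lo, b :: li =>
    let x := rep G a.2 in
    let y := rep G b.1 in
    let G1 := if u == x then delete_loop G u a else G in
    let G2 := if y == z then delete_loop G1 z b else G1 in
    (G2, visit_bwd G2 (visit_fwd G2 (advance S u lo z li) x) y)
  | _, _ => (G, S)
  end.

Definition make_passive G S u z : search :=
  let s := thr S in
  let fmove := before G s u in
  let bmove := before G z s in
  Search (fwd S) (bwd S) (outp S) (inp S)
    (if fmove then factive S :\ u else factive S)
    (if fmove then u |: fpassive S else fpassive S)
    (if bmove then bactive S :\ z else bactive S)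
    (if bmove then z |: bpassive S else bpassive S)
    s.

(* The body of the loop for the pair (u, z), up to the tests "F_A = {}" and
   "B_A = {}" that end it. *)
Definition loop_body G S u z : state n * search :=
  if before G u z then search_step G S u z else (G, make_passive G S u z).

(* For u = z = s the body of the loop changes nothing, so that pair is not an
   admissible choice. *)
Definition admissible S u z : bool :=
  [&& u \in factive S, z \in bactive S & ~~ ((u == thr S) && (z == thr S))].

Definition fwd_empty S : search :=
  Search (fwd S) (bwd S) (outp S) (inp S)
    (factive S) (fpassive S) (bactive S :\ thr S) set0 (thr S).

Definition bwd_empty S : search :=
  Search (fwd S) (bwd S) (outp S) (inp S)
    (factive S :\ thr S) set0 (bactive S) (bpassive S) (thr S).

Definition fwd_threshold G S s : search :=
  Search (fwd S) (bwd S) (outp S) (inp S)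
    [set x in fpassive S | before_eq G x s]
    [set x in fpassive S | ~~ before_eq G x s]
    (bactive S) (bpassive S) s.

Definition bwd_threshold G S s : search :=
  Search (fwd S) (bwd S) (outp S) (inp S)
    (factive S) (fpassive S)
    [set x in bpassive S | before_eq G s x]
    [set x in bpassive S | ~~ before_eq G s x] s.

(** * Merging and reordering after the search for the arc a *)

Section Update.
Variables (G : state n) (a : darc n) (S : search).
Let v := rep G a.1.
Let w := rep G a.2.

Definition live : {set 'I_n} := [set x in fwd S | ~~ is_null (outp S x)].

(* The minimum, in topological order, of {f(v)} and the live vertices. *)
Definition tvertex : 'I_n :=
  [arg min_(x < v in v |: live) index x (toporder G)].

Definition Flt : {set 'I_n} := [set x in fwd S | before G x tvertex].
Definition Bgt : {set 'I_n} := [set y in bwd S | before G tvertex y].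

Definition Xset : {set 'I_n} := Flt :|: [set tvertex] :|: Bgt.

Definition scanned : seq (darc n) :=
  flatten [seq outs G x | x <- enum Flt] ++
  flatten [seq ins G y | y <- enum Bgt].

(* Neither is f(v) in F_< nor f(w) in B_>, so the arc (f(v), f(w)) that is
   being added is not among the scanned ones; it belongs to every cycle. *)
Definition Yarcs : seq (darc n) :=
  (v, w) :: [seq e <- [seq (rep G b.1, rep G b.2) | b <- scanned]
                 | e.1 != e.2].

Definition Yrel : rel 'I_n :=
  fun x y => [&& x \in Xset, y \in Xset & (x, y) \in Yarcs].

(* The strong component of f(v) in the graph (X, Y); it is {f(v)} if and only
   if the new arc creates no new component. *)
Definition component : {set 'I_n} :=
  [set x in Xset | connect Yrel v x && connect Yrel x v].

Definition topological (l : seq 'I_n) : bool :=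
  all (fun e => (e.1 \in l) && (e.2 \in l) ==> (index e.1 l < index e.2 l))
      Yarcs.

Definition topological_listing (A : {set 'I_n}) (l : seq 'I_n) : bool :=
  perm_eq l (enum A) && topological l.

Definition reorder (lF lB : seq 'I_n) : seq 'I_n :=
  if tvertex == v then
    let o := [seq x <- toporder G | x \notin Flt] in
    let i := (index tvertex o).+1 in
    take i o ++ lF ++ drop i o
  else
    let o := [seq x <- toporder G | x \notin Flt :|: Bgt] in
    let i := index tvertex o in
    take i o ++ lB ++ lF ++ drop i o.

Definition new_rep : 'I_n -> 'I_n :=
  fun x => if rep G x \in component then v else rep G x.

(* [ko] and [ki] are the orders in which the lists of the old components are
   concatenated. *)
Definition new_state (lF lB ko ki : seq 'I_n) : state n :=
  State new_rep
    [seq x <- reorder lF lB | new_rep x == x]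
    (fun x => if x == v then flatten [seq outs G k | k <- ko]
              else if x \in component then [::] else outs G x)
    (fun x => if x == v then flatten [seq ins G k | k <- ki]
              else if x \in component then [::] else ins G x).

(* Computing t, F_< and B_>; scanning the lists to build Y; the linear-time
   static algorithm on (X, Y); the unite operations, concatenations and
   deletions of vertices that are no longer canonical; the moves. *)
Definition update_time : nat :=
  (#|fwd S| + #|bwd S|) + size scanned + (#|Xset| + size Yarcs)
  + #|component| + (#|Flt| + #|Bgt|).

End Update.

(** * The algorithm as a transition system *)

(* In all configurations, [p] is the list of the arcs that remain to be added
   (after [a], when an addition is in progress). *)
Inductive config :=
| Start (o : seq 'I_n) (p : seq (darc n))
| Idle G (p : seq (darc n))
| Loop G a (p : seq (darc n)) S
| TestF G a (p : seq (darc n)) S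
| PickF G a (p : seq (darc n)) S  (* about to choose a new s in F_P *)
| TestB G a (p : seq (darc n)) S
| PickB G a (p : seq (darc n)) S. (* about to choose a new s in B_P *)

(* [step c k c']: the algorithm can go from c to c' in time k.  Every
   operation that takes constant (possibly amortized) time -- find, unite,
   query, insertion or deletion in the ordered list, list and pointer
   operations, changes of membership -- counts as one unit, up to a constant
   factor: a step that performs a bounded number of them has time 1. *)
Inductive step : config -> nat -> config -> Prop :=
| step_start o p :
    step (Start o p) n (Idle (init_state o) p)
| step_insert G a p i j :
    ~~ before G (rep G a.2) (rep G a.1) ->
    step (Idle G (a :: p)) 1 (Idle (insert_arc G a i j) p)
| step_search G a p i j :
    before G (rep G a.2) (rep G a.1) ->
    let G' := insert_arc G a i j in
    step (Idle G (a :: p)) 1 (Loop G' a p (init_search G' a))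
| step_loop G a p S u z :
    admissible S u z ->
    let GS := loop_body G S u z in
    step (Loop G a p S) 1 (TestF GS.1 a p GS.2)
| step_nonemptyF G a p S :
    factive S != set0 ->
    step (TestF G a p S) 1 (TestB G a p S)
| step_emptyF G a p S :
    factive S = set0 ->
    step (TestF G a p S) 1
      (if fpassive S == set0 then TestB G a p (fwd_empty S)
       else PickF G a p (fwd_empty S))
| step_nonemptyB G a p S :
    bactive S != set0 ->
    step (TestB G a p S) 1 (Loop G a p S)
| step_emptyB G a p S :
    bactive S = set0 ->
    step (TestB G a p S) 1
      (if bpassive S == set0 then Loop G a p (bwd_empty S)
       else PickB G a p (bwd_empty S))
| step_update G a p S lF lB ko ki :
    (forall u z, ~~ admissible S u z) ->
    topological_listing G a S (Flt G a S) lF ->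
    topological_listing G a S (Bgt G a S) lB ->
    perm_eq ko (enum (component G a S)) ->
    perm_eq ki (enum (component G a S)) ->
    step (Loop G a p S) (update_time G a S)
         (Idle (new_state G a S lF lB ko ki) p).

(* The selection of a new threshold: the set of choices, the configuration
   that follows the choice of s, and the order on the choices. *)
Definition choices (c : config) : {set 'I_n} :=
  match c with
  | PickF _ _ _ Q => fpassive Q
  | PickB _ _ _ Q => bpassive Q
  | _ => set0
  end.

Definition set_threshold (c : config) s : config :=
  match c with
  | PickF G a p Q => TestB G a p (fwd_threshold G Q s)
  | PickB G a p Q => Loop G a p (bwd_threshold G Q s)
  | _ => c
  end.

Definition config_le (c : config) : rel 'I_n :=
  match c with
  | PickF G _ _ _ | PickB G _ _ _ => before_eq G
  | _ => fun _ _ => false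
  end.

(* At least a fraction 1/k of the elements of A are <= s, and at least a
   fraction 1/k are >= s. *)
Definition approx_median (k : nat) (le : rel 'I_n) (A : {set 'I_n}) s : Prop :=
  #|A| <= k * #|[set x in A | le x s]| /\ #|A| <= k * #|[set x in A | le s x]|.

Definition median (le : rel 'I_n) (A : {set 'I_n}) s : Prop :=
  approx_median 2 le A s.

(** * Total time *)

(* Finding an (approximate) median in linear time, or choosing at random, and
   then moving the appropriate vertices takes time #|choices c|. *)

(* [run rule c T]: some execution from c, in which each new threshold obeys
   [rule], has used time T at some moment.  Executions can be interrupted at
   any moment ([run_stop]); as all transitions out of configurations other
   than [Start] have positive time, a bound on T also bounds the number of
   transitions and so includes termination. *)
Inductive run (rule : rel 'I_n -> {set 'I_n} -> 'I_n -> Prop) :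
    config -> nat -> Prop :=
| run_stop c : run rule c 0
| run_step c k c' T :
    step c k c' -> run rule c' T -> run rule c (k + T)
| run_pick c s T :
    s \in choices c -> rule (config_le c) (choices c) s ->
    run rule (set_threshold c s) T ->
    run rule c (#|choices c| + T).

(* [expected_run c E]: for some way of making the arbitrary choices of the
   algorithm, which may depend on the whole past (including the thresholds
   drawn so far), and of interrupting it, the expected time used from c is E
   when each new threshold is drawn uniformly at random. *)
Inductive expected_run (R : rcfType) : config -> R -> Prop :=
| expected_stop c : expected_run c 0%R
| expected_step c k c' E :
    step c k c' -> expected_run c' E -> expected_run c (k%:R + E)%R
| expected_pick c (E : 'I_n -> R) :
    choices c != set0 ->
    (forall s, s \in choices c -> expected_run (set_threshold c s) (E s)) ->
    expected_run c
      (#|choices c|%:R + (\sum_(s in choices c) E s) / #|choices c|%:R)%R.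

End Algorithm.

(* Main.v *)
Require Import Defs.
From mathcomp Require Import all_boot all_order all_algebra.
From mathcomp Require Import zify ring lra.
Import GRing.Theory Num.Theory.

Set Implicit Arguments.
Unset Strict Implicit.
Unset Printing Implicit Defensive.

(** Let N be the number of ordered pairs (b, a) of arcs such that the head of b
    reaches the tail of a; it never decreases and is at most m^2.  A search that
    makes k traversals pairs forward arcs a_i with backward arcs b_i such that
    tail a_i < head b_i in the topological order.  For any i and j, one of
    tail a_i < head b_j and tail a_j < head b_i holds, so at least k^2/2 pairs
    (b_j, a_i) are in order; they are unrelated before the addition of (v, w) and
    related after it, because head b_j reaches v and w reaches tail a_i.  Hence
    the sum of the k^2 over all searches is O(m^2), and the sum of the k is
    O(m^(3/2)) by Cauchy-Schwarz, used here in the additive form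
    k <= sqrt m + (k^2/2) / sqrt m.

    A search with k traversals takes time O(k).  A threshold chosen among p
    passive vertices, a of them at most s and b of them at least s, costs p, but
    before the next choice on the same side either the a vertices are exhausted
    or the b vertices are dropped for good.  The potential [phi] therefore falls
    by min(a, b) at the choice; this is at least p/k for approximate medians, and
    at least p/6 on average for random thresholds.

    The counting needs the order maintained by the algorithm to be topological,
    and hence the correctness of the reordering.  Its crux is that at the end of
    a search no vertex with an unexhausted forward pointer precedes one with an
    unexhausted backward pointer, so that F_< and B_> are fully explored. *)

(** * Invariants of the data structure *)

Section Structure.
Variable n : nat.
Implicit Types (G : state n) (a : darc n) (E : seq (darc n)).
Implicit Types (x y : 'I_n) (rp : 'I_n -> 'I_n) (key : darc n -> 'I_n).
Implicit Types (l : 'I_n -> seq (darc n)).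

Definition pos G x := index x (toporder G).

Definition arc_rel E : rel 'I_n := fun x y => (x, y) \in E.

(** Completeness concerns only arcs between distinct components, because the searches delete
    loops. *)
Record lists_ok rp E key l : Prop := ListsOk {
  lists_uniq : forall x, uniq (l x);
  lists_sound : forall x a, a \in l x -> a \in E /\ rp (key a) = x;
  lists_complete :
    forall a, a \in E -> rp a.1 != rp a.2 -> a \in l (rp (key a))
}.

Record wf G E : Prop := Wf {
  wf_rep : forall x, rep G (rep G x) = rep G x;
  wf_uniq : uniq (toporder G);
  wf_mem : forall x, (x \in toporder G) = (rep G x == x);
  wf_connect : forall x y, rep G x = rep G y -> connect (arc_rel E) x y;
  wf_outs : lists_ok (rep G) E fst (outs G);
  wf_ins : lists_ok (rep G) E snd (ins G)
}.

(** The inequality is weak because both ends of an arc may lie in one component. Together with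
    [pos_inj] and [wf_connect] it makes the classes of [rep] exactly the strong components. *)
Definition sorted_arcs G E : Prop :=
  forall a, a \in E -> pos G (rep G a.1) <= pos G (rep G a.2).

Lemma pos_inj G E x y :
  wf G E -> rep G x = x -> rep G y = y -> pos G x = pos G y -> x = y.
Proof.
move=> wfG rx ry eq_xy; apply: (index_inj x (s := toporder G)) eq_xy.
  by rewrite (wf_mem wfG) rx.
by rewrite (wf_mem wfG) ry.
Qed.

Lemma connect_subseq E E' :
  {subset E <= E'} -> subrel (connect (arc_rel E)) (connect (arc_rel E')).
Proof. by move=> sEE'; apply: connect_sub => x y xy; apply/connect1/sEE'. Qed.

Lemma sorted_arcs_connect G E x y :
  sorted_arcs G E -> connect (arc_rel E) x y ->
  pos G (rep G x) <= pos G (rep G y).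
Proof.
move=> sG /connectP[p pth ->]; elim: p x pth => //= z p IHp x /andP[xz pth].
exact: leq_trans (sG _ xz) (IHp _ pth).
Qed.

Lemma perm_insert_at i a (s : seq (darc n)) :
  perm_eq (insert_at i a s) (a :: s).
Proof.
by rewrite perm_sym -{1}(cat_take_drop i s) -cat1s perm_catCA.
Qed.

Lemma lists_ok_insert rp E key l a i :
  a \notin E -> lists_ok rp E key l ->
  lists_ok rp (a :: E) key
    [eta l with rp (key a) |-> insert_at i a (l (rp (key a)))].
Proof.
move=> aE [lu ls lc]; split=> [x|x b|b] /=.
- case: eqP => // _; rewrite (perm_uniq (perm_insert_at i a _)) /= lu andbT.
  by apply/negP => /ls[]; rewrite (negbTE aE).
- case: eqP => [->|_].
    rewrite (perm_mem (perm_insert_at i a _)) !inE => /orP[/eqP->|/ls[-> ->]].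
      by rewrite eqxx.
    by rewrite orbT.
  by rewrite inE => /ls[-> ->]; rewrite orbT.
rewrite inE => bE nb.
case: eqP => [eq_b|ne_b].
  rewrite (perm_mem (perm_insert_at i a _)) !inE.
  case/orP: bE => [->//|bE].
  by rewrite -eq_b lc ?orbT.
case/orP: bE => [/eqP eq_ba|bE]; last exact: lc.
by rewrite eq_ba in ne_b.
Qed.

Lemma lists_ok_delete rp E key l x a :
  rp a.1 = rp a.2 -> lists_ok rp E key l ->
  lists_ok rp E key [eta l with x |-> rem a (l x)].
Proof.
move=> loop_a [lu ls lc]; split=> [y|y b|b bE nb] /=.
- by case: eqP => // _; apply: rem_uniq.
- by case: eqP => [->|_]; [move/mem_rem|]; apply: ls.
case: eqP => [eq_b|_]; last exact: lc.
rewrite mem_rem_uniq // inE -eq_b lc // andbT.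
by apply: contraNneq nb => ->; rewrite loop_a.
Qed.

Lemma wf_insert G E a i j :
  wf G E -> a \notin E -> wf (insert_arc G a i j) (a :: E).
Proof.
case=> wr wu wm wc wo wi aE; split=> //=.
- move=> x y /wc; apply: connect_subseq => b bE; rewrite inE bE orbT //.
- exact: lists_ok_insert.
- exact: lists_ok_insert.
Qed.

Lemma wf_delete G E x a :
  rep G a.1 = rep G a.2 -> wf G E -> wf (delete_loop G x a) E.
Proof.
move=> loop_a [wr wu wm wc wo wi]; split=> //=; exact: lists_ok_delete.
Qed.

Lemma wf_init (o : seq 'I_n) : perm_eq o (enum 'I_n) -> wf (init_state o) [::].
Proof.
move=> po; split=> //=.
- by rewrite (perm_uniq po) enum_uniq.
- by move=> x; rewrite (perm_mem po) mem_enum eqxx.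
- by move=> x y ->.
Qed.

End Structure.

(** * Invariants of the search *)

Section Side.
Variables (n : nat) (rp : 'I_n -> 'I_n) (E : seq (darc n)).
Variables (key oth : darc n -> 'I_n) (cn : rel 'I_n) (r : 'I_n).
Implicit Types (a : darc n) (x y u : 'I_n) (l ptr : 'I_n -> seq (darc n)).
Implicit Types (V act pas : {set 'I_n}) (tr : seq (darc n)).

(* One direction of the search from the root [r], with trace [tr]: [key] and
   [oth] are [fst] and [snd] for the forward search and are exchanged for the
   backward one, and [cn] is reachability, reversed for the backward search. *)
Record side l V ptr act pas tr : Prop := Side {
  side_root : r \in V;
  side_rep : forall x, x \in V -> rp x = x;
  side_uniq : uniq tr;
  side_tr : forall a, a \in tr ->
    [/\ a \in E, rp (key a) \in V, rp (oth a) \in V & a \notin ptr (rp (key a))];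
  side_ptr : forall x, x \in V ->
    uniq (ptr x) /\ forall a, a \in ptr x -> a \in E /\ rp (key a) = x;
  side_list : forall x a, x \in V -> a \in l x -> (a \in tr) || (a \in ptr x);
  side_pred : forall x, x \in V -> x <> r -> exists a,
    [/\ a \in E, rp (oth a) = x, rp (key a) \in V & rp (key a) != x];
  side_conn : forall x, x \in V -> cn r x;
  side_act : forall x, x \in act -> x \in V /\ ptr x <> [::];
  side_pas : forall x, x \in pas -> x \in V /\ ptr x <> [::];
  side_disj : forall x, x \in act -> x \notin pas;
  side_size : #|V| <= (size tr).+1
}.

Lemma side_init l :
  lists_ok rp E key l -> rp r = r -> cn r r ->
  side l [set r] [eta (fun _ => [::]) with r |-> l r]
    (if is_null (l r) then set0 else [set r]) set0 [::].
Proof.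
move=> [lu ls lc] rr cr; split=> //=.
- exact: set11.
- by move=> x /set1P->.
- by move=> x /set1P->; rewrite eqxx; split=> // a /ls.
- by move=> x a /set1P->; rewrite eqxx.
- by move=> x /set1P->.
- by move=> x /set1P->.
- move=> x; case: ifP => [_|nl]; first by rewrite inE.
  by move=> /set1P->; rewrite set11 eqxx; split=> //; move: nl; case: (l r).
- by move=> x; rewrite inE.
- by move=> x; rewrite inE.
- by rewrite cards1.
Qed.

Lemma side_reclassify l V ptr act pas tr act' pas' :
  side l V ptr act pas tr ->
  act' \subset act :|: pas -> pas' \subset act :|: pas ->
  (forall x, x \in act' -> x \notin pas') ->
  side l V ptr act' pas' tr.
Proof.
case=> sr srep su st sp sl spr sc sa sps sd ss /subsetP sA /subsetP sP dA.
split=> // x.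
- by move=> /sA /setUP[/sa|/sps].
- by move=> /sP /setUP[/sa|/sps].
Qed.

(** * Traversal of one arc in one direction *)

Section Step.
Variables (l l' : 'I_n -> seq (darc n)) (V : {set 'I_n}).
Variables (ptr : 'I_n -> seq (darc n)) (act pas : {set 'I_n}).
Variables (tr : seq (darc n)) (u : 'I_n) (a : darc n) (lo : seq (darc n)).
Hypotheses (S : side l V ptr act pas tr) (lists : lists_ok rp E key l').
Hypothesis sub_l : forall x, {subset l' x <= l x}.
Hypothesis rpK : forall x, rp (rp x) = rp x.
Hypothesis cn_trans : forall x y z, cn x y -> cn y z -> cn x z.
Hypothesis cn_rep : forall x y, rp x = rp y -> cn x y.
Hypothesis cn_arc : forall b, b \in E -> cn (key b) (oth b).
Hypotheses (u_act : u \in act) (ptr_u : ptr u = a :: lo).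

Let x := rp (oth a).
Let V' := if x \in V then V else x |: V.
Let ptr1 := [eta ptr with u |-> lo].
Let ptr' := if x \in V then ptr1 else [eta ptr1 with x |-> l' x].
Let act1 := if is_null lo then act :\ u else act.
Let act' := if x \in V then act1
            else if is_null (l' x) then act1 else x |: act1.

(** This is what preserves [sv_cross]: a vertex live after the step either was live before and is
    not abandoned by the step, or is the vertex just visited and is active. *)
Lemma side_step_live y : y \in V' -> ptr' y <> [::] ->
  [/\ y \in V, ptr y <> [::] & y \in act :|: pas -> y \in act' :|: pas]
  \/ [/\ y \notin V, y = x & y \in act'].
Proof.
have uV : u \in V by have [] := side_act S u_act.
rewrite /V' /ptr' /act' /act1 /ptr1.
case: (boolP (x \in V)) => xV /=.
  move=> yV; case: (eqVneq y u) => [->|ne_yu] py; left; split=> //.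
  - by rewrite ptr_u.
  - by case: (lo) py => //= _ _; rewrite inE u_act.
  - by rewrite !inE => /orP[yA|->]; rewrite ?orbT //;
      case: ifP; rewrite ?inE ?ne_yu yA.
case/setU1P => [->|yV].
  by rewrite eqxx; case: (l' x) => //= b s _; right; rewrite setU11.
have ne_yx : y != x by apply: contraNneq xV => <-.
rewrite (negPf ne_yx); case: (eqVneq y u) => [->|ne_yu] py; left; split=> //.
- by rewrite ptr_u.
- by case: (lo) py => //= b s _; case: ifP; rewrite !inE u_act ?orbT.
- by rewrite !inE => /orP[yA|->]; rewrite ?orbT //;
    do 2![case: ifP => _]; rewrite ?inE ?ne_yu yA ?orbT.
Qed.

(** The lists [l'] are those left after the deletion of loops. Pointers already set still run over
    the old lists, so inclusion of [l'] in [l] suffices for [side_list]. *)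
Lemma side_step : side l' V' ptr' act' pas (a :: tr).
Proof.
have [sr srep su st sp sl spr sc sa sps sd ss] := S.
have [uV _] := sa _ u_act.
have [] := sp _ uV; rewrite ptr_u /= => /andP[a_lo lo_u] pu.
have [aE key_a] := pu a (mem_head _ _).
have cx : cn r x.
  apply: cn_trans (sc _ uV) _; apply: (@cn_trans _ (key a)).
    by apply: cn_rep; rewrite -key_a rpK.
  by apply: cn_trans (cn_arc aE) _; apply: cn_rep; rewrite /x rpK.
have sVV' : {subset V <= V'}.
  by move=> y yV; rewrite /V'; case: ifP => // _; rewrite inE yV orbT.
have xV' : x \in V'.
  by rewrite /V'; case: ifP => // _; rewrite setU11.
have V'P y : y \in V' -> y \in V \/ x \notin V /\ y = x.
  rewrite /V'; case: (boolP (x \in V)) => [_|xV]; first by left.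
  by case/setU1P => [->|]; [right|left].
have ptrP y : y \in V -> ptr' y = if y == u then lo else ptr y.
  move=> yV; rewrite /ptr'; case: ifP => //= xV.
  by case: eqP => // eq_yx; rewrite -eq_yx yV in xV.
have ptrx : x \notin V -> ptr' x = l' x.
  by move=> /negPf xV; rewrite /ptr' xV /= eqxx.
(* Arcs of the trace lie behind their pointers, while [a] was still ahead of the pointer of [u]. *)
have a_tr : a \notin tr.
  by apply/negP => /st[_ _ _]; rewrite key_a ptr_u mem_head.
have sub_act y : y \in act1 -> y \in act.
  by rewrite /act1; case: ifP => // _; case/setD1P.
split=> //.
- exact: sVV'.
- by move=> y /V'P[/srep//|[_ ->]]; rewrite /x rpK.
- by rewrite /= a_tr.
- move=> b; rewrite inE => /orP[/eqP->|bt].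
    by split=> //; [apply: sVV'; rewrite key_a|rewrite key_a ptrP // eqxx].
  have [bE kb ob nb] := st _ bt; split=> //; try exact: sVV'.
  rewrite ptrP //; case: eqP => // eq_u; move: nb.
  by rewrite eq_u ptr_u inE negb_or => /andP[].
- move=> y /V'P[yV|[xV ->]].
    rewrite ptrP //; case: eqP => [->|_]; last exact: sp.
    by split=> // b bl; apply: pu; rewrite inE bl orbT.
  rewrite ptrx //; split; first exact: (lists_uniq lists).
  exact: (lists_sound lists).
- move=> y b /V'P[yV|[xV ->]].
    move=> /sub_l /(sl _ _ yV); rewrite ptrP // inE -orbA.
    case: (eqVneq y u) => [->|_]; last by case/orP=> bt; rewrite bt ?orbT.
    by rewrite ptr_u inE => /or3P[] bt; rewrite bt ?orbT.
  by rewrite ptrx // => ->; rewrite orbT.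
- move=> y /V'P[yV|[xV ->]] ne_yr.
    by have [b [? ? ? ?]] := spr _ yV ne_yr; exists b; split=> //; apply: sVV'.
  exists a; split=> //; first by apply: sVV'; rewrite key_a.
  by rewrite key_a; apply: contraNneq xV => <-.
- by move=> y /V'P[/sc//|[_ ->]].
- move=> y yA.
  have [yA1|[xV [eq_yx lx]]] :
      y \in act1 \/ x \notin V /\ y = x /\ l' x <> [::].
    move: yA; rewrite /act'; case: (boolP (x \in V)) => xV; first by left.
    case lx: (l' x) => [|b s] /=; first by left.
    by case/setU1P => [->|]; [right|left].
  - have [yV py] := sa _ (sub_act _ yA1); split; first exact: sVV'.
    rewrite ptrP //; move: yA1; rewrite /act1; case: (eqVneq y u) => [->|//].
    by case: (lo) => [|? ?] //=; rewrite !inE eqxx.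
  - by rewrite eq_yx ptrx.
- move=> y yP; have [yV py] := sps _ yP; split; first exact: sVV'.
  rewrite ptrP //; case: eqP => // eq_yu.
  by have := sd _ u_act; rewrite -eq_yu yP.
- move=> y; rewrite /act'; case: (boolP (x \in V)) => xV.
    by move/sub_act/sd.
  have xP : x \notin pas by apply: contraNN xV => /sps[].
  case: ifP => _; first by move/sub_act/sd.
  by case/setU1P => [->|/sub_act/sd].
- rewrite /= /V'; case: ifP => _; first exact: leqW.
  by rewrite cardsU1 -add1n leq_add // leq_b1.
Qed.

End Step.
End Side.

(** * The two directions of the search together *)

Section Search.
Variable n : nat.
Implicit Types (G : state n) (a b : darc n) (E : seq (darc n)) (S : search n).
Implicit Types (x y u z s : 'I_n) (L : seq (darc n * darc n)).

(* [sv_cross] fails only for pairs abandoned with a threshold s: when B_A is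
   empty, F_P and s itself can be dropped because the live vertices of B that
   are not yet abandoned are all < s, while F_P > s; and symmetrically. *)
Record search_inv G a E S L : Prop := SearchInv {
  sv_wf : wf G (a :: E);
  sv_sorted : sorted_arcs G E;
  sv_new : before G (rep G a.2) (rep G a.1);
  sv_f : side (rep G) (a :: E) fst snd (connect (arc_rel (a :: E)))
    (rep G a.2) (outs G) (fwd S) (outp S) (factive S) (fpassive S) (unzip1 L);
  sv_b : side (rep G) (a :: E) snd fst
    (fun x y => connect (arc_rel (a :: E)) y x)
    (rep G a.1) (ins G) (bwd S) (inp S) (bactive S) (bpassive S) (unzip2 L);
  sv_pairs : forall p, p \in L -> before G (rep G p.1.1) (rep G p.2.2);
  sv_thr : rep G (thr S) = thr S;
  sv_fpas : forall x, x \in fpassive S -> before G (thr S) x;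
  sv_bpas : forall x, x \in bpassive S -> before G x (thr S);
  sv_cross : forall x y, x \in fwd S -> y \in bwd S ->
    outp S x <> [::] -> inp S y <> [::] -> before G x y ->
    (x \in factive S :|: fpassive S) /\ (y \in bactive S :|: bpassive S);
  sv_lo : forall x, x \in fwd S -> before_eq G (rep G a.2) x;
  sv_hi : forall x, x \in bwd S -> before_eq G x (rep G a.1)
}.

Lemma search_inv_init G a E :
  wf G (a :: E) -> sorted_arcs G E -> before G (rep G a.2) (rep G a.1) ->
  search_inv G a E (init_search G a) [::].
Proof.
move=> wfG sG nG; have rK := wf_rep wfG.
split=> //=.
- by apply: side_init => //; exact: wf_outs wfG.
- by apply: side_init => //; exact: wf_ins wfG.
- by move=> x; rewrite inE.
- by move=> x; rewrite inE.
- move=> x y /set1P-> /set1P->; rewrite !eqxx.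
  by case: (outs G _) (ins G _) => [|? ?] [|? ?] //=; rewrite !inE !eqxx.
- by move=> x /set1P->; rewrite /before_eq.
- by move=> x /set1P->; rewrite /before_eq.
Qed.

Lemma conditional_delete G E (c : bool) x b :
  (c -> rep G b.1 = rep G b.2) -> wf G E ->
  let G' := if c then delete_loop G x b else G in
  [/\ wf G' E, rep G' = rep G, toporder G' = toporder G,
      forall y, {subset outs G' y <= outs G y} &
      forall y, {subset ins G' y <= ins G y}].
Proof.
case: c => [/(_ isT) loop_b|_] wfG G'; last first.
  by split=> // y d.
split=> //=.
- exact: wf_delete.
- by move=> y d; case: (eqVneq y x) => [->|_] //; apply: mem_rem.
- by move=> y d; case: (eqVneq y x) => [->|_] //; apply: mem_rem.
Qed.

(** Every move other than a traversal only redistributes live vertices. The last hypothesis is the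
    real obligation: a vertex may be given up only if it forms no pair in order with a vertex still
    held on the other side. *)
Lemma search_inv_reclassify G a E S L (fa fp ba bp : {set 'I_n}) s :
  search_inv G a E S L ->
  fa \subset factive S :|: fpassive S -> fp \subset factive S :|: fpassive S ->
  ba \subset bactive S :|: bpassive S -> bp \subset bactive S :|: bpassive S ->
  (forall x, x \in fa -> x \notin fp) -> (forall x, x \in ba -> x \notin bp) ->
  rep G s = s ->
  (forall x, x \in fp -> before G s x) -> (forall x, x \in bp -> before G x s) ->
  (forall x y, x \in factive S :|: fpassive S ->
     y \in bactive S :|: bpassive S -> before G x y ->
     (x \in fa :|: fp) /\ (y \in ba :|: bp)) ->
  search_inv G a E
    (Search (fwd S) (bwd S) (outp S) (inp S) fa fp ba bp s) L.
Proof.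
case=> iw is0 inw if0 ib ipr it ifp ibp ic il ih sfa sfp sba sbp df db rs hfp hbp hc.
split=> //=.
- exact: side_reclassify if0 _ _ _.
- exact: side_reclassify ib _ _ _.
- by move=> x y xF yB ox iy xy; have [? ?] := ic x y xF yB ox iy xy; apply: hc.
Qed.

Lemma loop_arc_first G a E S L u :
  search_inv G a E S L -> u \in factive S ->
  exists b lo, [/\ outp S u = b :: lo, b \in a :: E & rep G b.1 = u].
Proof.
move=> iS uA; have [uF] := side_act (sv_f iS) uA.
case eu: (outp S u) => [//|b lo] _; exists b, lo; split=> //;
by have [_ /(_ b)[]] := side_ptr (sv_f iS) uF; rewrite ?eu ?mem_head.
Qed.

Lemma loop_arc_last G a E S L z :
  search_inv G a E S L -> z \in bactive S ->
  exists b li, [/\ inp S z = b :: li, b \in a :: E & rep G b.2 = z].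
Proof.
move=> iS zA; have [zB] := side_act (sv_b iS) zA.
case ez: (inp S z) => [//|b li] _; exists b, li; split=> //;
by have [_ /(_ b)[]] := side_ptr (sv_b iS) zB; rewrite ?ez ?mem_head.
Qed.

Lemma search_step_inv G a E S L u z :
  search_inv G a E S L -> u \in factive S -> z \in bactive S -> before G u z ->
  let GS := search_step G S u z in
  exists p, search_inv GS.1 a E GS.2 (p :: L) /\
    exists x y, (rep GS.1 = rep G /\ toporder GS.1 = toporder G) /\
      [/\ factive GS.2 \subset x |: factive S, bactive GS.2 \subset y |: bactive S,
      fpassive GS.2 = fpassive S, bpassive GS.2 = bpassive S &
      thr GS.2 = thr S].
Proof.
move=> iS uA zA uz.
have [b [lo [eu bE rb]]] := loop_arc_first iS uA.
have [d [li [ez dE rd]]] := loop_arc_last iS zA.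
rewrite /search_step eu ez.
set x := rep G b.2; set y := rep G d.1.
have wfG := sv_wf iS; have rK := wf_rep wfG.
have loop_b : u == x -> rep G b.1 = rep G b.2 by rewrite rb => /eqP.
have loop_d : y == z -> rep G d.1 = rep G d.2 by rewrite rd => /eqP.
set G1 := if u == x then _ else _.
have [w1 r1 t1 so1 si1] : _ := conditional_delete u loop_b wfG.
rewrite -/G1 in w1 r1 t1 so1 si1.
have loop_d1 : y == z -> rep G1 d.1 = rep G1 d.2 by rewrite r1.
have [w2 r2 t2 so2 si2] : _ := conditional_delete z loop_d1 w1.
set G2 := if y == z then _ else _ in w2 r2 t2 so2 si2 *.
rewrite r1 in r2; rewrite t1 in t2.
have so : forall v, {subset outs G2 v <= outs G v} by move=> v e /so2/so1.
have si : forall v, {subset ins G2 v <= ins G v} by move=> v e /si2/si1.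
have bG v w : before G2 v w = before G v w by rewrite /before t2.
have beG v w : before_eq G2 v w = before_eq G v w by rewrite /before_eq t2.
have lo2 := wf_outs w2; have li2 := wf_ins w2; rewrite r2 in lo2 li2.
have cT v1 v2 v3 : connect (arc_rel (a :: E)) v1 v2 ->
  connect (arc_rel (a :: E)) v2 v3 -> connect (arc_rel (a :: E)) v1 v3.
  exact: connect_trans.
have cR v1 v2 : rep G v1 = rep G v2 -> connect (arc_rel (a :: E)) v1 v2.
  exact: (wf_connect wfG).
have cA e : e \in a :: E -> connect (arc_rel (a :: E)) e.1 e.2.
  by move=> eE; apply: connect1; rewrite /arc_rel -surjective_pairing.
have Sf := side_step (sv_f iS) lo2 so rK cT cR cA uA eu.
have Lf := side_step_live (sv_f iS) (l' := outs G2) uA eu.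
have cT' v1 v2 v3 : connect (arc_rel (a :: E)) v2 v1 ->
  connect (arc_rel (a :: E)) v3 v2 -> connect (arc_rel (a :: E)) v3 v1.
  by move=> v21 v32; exact: connect_trans v32 v21.
have cR' v1 v2 : rep G v1 = rep G v2 -> connect (arc_rel (a :: E)) v2 v1.
  by move=> e12; apply: (wf_connect wfG).
have Sb := side_step (cn := fun x y => connect (arc_rel (a :: E)) y x)
  (sv_b iS) li2 si rK cT' cR' cA zA ez.
have Lb := side_step_live (sv_b iS) (l' := ins G2) zA ez.
rewrite -/x in Sf Lf; rewrite -/y in Sb Lb.
have [uF ou] := side_act (sv_f iS) uA.
have [zB iz] := side_act (sv_b iS) zA.
(* Old arcs respect the order, and the new arc leads to the root, which is already visited. *)
have hx : x \notin fwd S -> pos G u <= pos G x.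
  move: bE; rewrite inE => /orP[/eqP eb|/(sv_sorted iS)]; last by rewrite rb.
  by rewrite /x eb (side_root (sv_f iS)).
have hy : y \notin bwd S -> pos G y <= pos G z.
  move: dE; rewrite inE => /orP[/eqP ed|/(sv_sorted iS)]; last by rewrite rd.
  by rewrite /y ed (side_root (sv_b iS)).
set T := visit_bwd _ _ _.
exists (b, d).
(* The nested updates are brought into the form of [side_step], one direction beside the other, so
   that [Sf] and [Sb] apply as they stand. *)
have eT : T = Search (if x \in fwd S then fwd S else x |: fwd S)
    (if y \in bwd S then bwd S else y |: bwd S)
    (if x \in fwd S then [eta outp S with u |-> lo]
     else [eta [eta outp S with u |-> lo] with x |-> outs G2 x])
    (if y \in bwd S then [eta inp S with z |-> li]
     else [eta [eta inp S with z |-> li] with y |-> ins G2 y])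
    (if x \in fwd S then if is_null lo then factive S :\ u else factive S
     else if is_null (outs G2 x)
          then if is_null lo then factive S :\ u else factive S
          else x |: if is_null lo then factive S :\ u else factive S)
    (fpassive S)
    (if y \in bwd S then if is_null li then bactive S :\ z else bactive S
     else if is_null (ins G2 y)
          then if is_null li then bactive S :\ z else bactive S
          else y |: if is_null li then bactive S :\ z else bactive S)
    (bpassive S) (thr S).
  rewrite /T /visit_bwd /visit_fwd /advance.
  by case: (boolP (x \in fwd S)) => _ /=; case: (boolP (y \in bwd S)) => _.
rewrite eT; split; last first.
  exists x, y; split=> //=; split=> //=.
  - apply/subsetP => v; rewrite !inE; do !case: ifP => _; rewrite ?inE;
    by do ?[case/orP]; do ?[case/andP]; move=> *; apply/orP; auto.
  - apply/subsetP => v; rewrite !inE; do !case: ifP => _; rewrite ?inE;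
    by do ?[case/orP]; do ?[case/andP]; move=> *; apply/orP; auto.
split=> //=.
- by move=> e eE; rewrite r2 /pos t2; apply: (sv_sorted iS).
- by rewrite r2 bG; apply: sv_new iS.
- by rewrite r2.
- by rewrite r2.
- move=> p; rewrite inE r2 bG => /orP[/eqP->/=|]; last exact: (sv_pairs iS).
  by rewrite rb rd.
- by rewrite r2; apply: sv_thr iS.
- by move=> v vP; rewrite bG; apply: (sv_fpas iS).
- by move=> v vP; rewrite bG; apply: (sv_bpas iS).
- move=> v w vF wB ov iw; rewrite bG => vw.
  (* A newly visited vertex is active. Paired with an old vertex, it is replaced by [u] or [z]
     through [hx] or [hy], and the old [sv_cross] applies to that pair. *)
  have [[vF0 ov0 vA]|[nv ev vA]] := Lf v vF ov;
  have [[wB0 iw0 wA]|[nw ew wA]] := Lb w wB iw.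
  + have [? ?] := sv_cross iS vF0 wB0 ov0 iw0 vw.
    by split; [apply: vA|apply: wA].
  + have vz : before G v z.
      by apply: leq_trans vw _; rewrite ew; apply: hy; rewrite -ew.
    have [vA' _] := sv_cross iS vF0 zB ov0 iz vz.
    by split; [apply: vA|apply/setUP; left].
  + have uw : before G u w.
      by apply: leq_ltn_trans vw; rewrite ev; apply: hx; rewrite -ev.
    have [_ wA'] := sv_cross iS uF wB0 ou iw0 uw.
    by split; [apply/setUP; left|apply: wA].
  + by split; apply/setUP; left.
- move=> v; rewrite beG r2; case: (boolP (x \in fwd S)) => [_|nx].
    exact: (sv_lo iS).
  case/setU1P => [->|]; last exact: (sv_lo iS).
  exact: leq_trans (sv_lo iS uF) (hx nx).
- move=> v; rewrite beG r2; case: (boolP (y \in bwd S)) => [_|ny].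
    exact: (sv_hi iS).
  case/setU1P => [->|]; last exact: (sv_hi iS).
  exact: leq_trans (hy ny) (sv_hi iS zB).
Qed.

End Search.

(** * Correctness of the reordering *)

Section BlockOrder.
Variable T : eqType.
Implicit Types (s o lB lF : seq T) (x y : T).

Lemma index_filter_le (P : pred T) s x y :
  index x s <= index y s -> P x ->
  index x (filter P s) <= index y (filter P s).
Proof.
elim: s => //= z s IHs; case: (eqVneq z x) => [->|zx].
  by move=> _ Px; rewrite Px /= eqxx.
case: (eqVneq z y) => [->|zy] //; rewrite ltnS => le_xy Px.
by case: ifP => _ /=; rewrite ?(negPf zx) ?(negPf zy) ?ltnS; apply: IHs.
Qed.

Lemma index_filter_lt (P : pred T) s x y :
  index x s < index y s -> P x ->
  index x (filter P s) < index y (filter P s).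
Proof.
elim: s => //= z s IHs; case: (eqVneq z x) => [->|zx].
  by case: (eqVneq x y) => //= ne _ Px; rewrite Px /= eqxx (negPf ne).
case: (eqVneq z y) => [->|zy] //; rewrite ltnS => lt_xy Px.
by case: ifP => _ /=; rewrite ?(negPf zx) ?(negPf zy) ?ltnS; apply: IHs.
Qed.

(** Weak, because the two ends of an arc may be contracted to one vertex. *)
Definition precedes s x y := index x s <= index y s.

Lemma precedes_catlr s1 s2 x y :
  x \in s1 -> y \notin s1 -> precedes (s1 ++ s2) x y.
Proof.
rewrite /precedes !index_cat => xs /negPf->; rewrite xs.
by apply: leq_trans (leq_addr _ _); rewrite index_size.
Qed.

Lemma precedes_catl s1 s2 x y :
  x \in s1 -> y \in s1 -> precedes (s1 ++ s2) x y = precedes s1 x y.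
Proof. by rewrite /precedes !index_cat => -> ->. Qed.

Lemma precedes_catr s1 s2 x y :
  x \notin s1 -> y \notin s1 -> precedes (s1 ++ s2) x y = precedes s2 x y.
Proof.
by rewrite /precedes !index_cat => /negPf-> /negPf->; rewrite leq_add2l.
Qed.

Section Blocks.
Variables (o lB lF : seq T) (i : nat).
Hypothesis oB : forall x, x \in o -> x \notin lB.
Hypothesis oF : forall x, x \in o -> x \notin lF.
Hypothesis BF : forall x, x \in lB -> x \notin lF.
Let M := take i o ++ lB ++ lF ++ drop i o.

Lemma blocks_old x y :
  x \in o -> y \in o -> precedes o x y -> precedes M x y.
Proof.
move=> xo yo.
have [xB yB xF yF] := And4 (oB xo) (oB yo) (oF xo) (oF yo).
case: (boolP (x \in take i o)) => xt; case: (boolP (y \in take i o)) => yt.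
- by rewrite -{1}(cat_take_drop i o) !precedes_catl.
- by rewrite precedes_catlr.
- move: xt yt; rewrite !in_take // -leqNgt => le_ix lt_yi le_xy.
  by have := leq_trans lt_yi (leq_trans le_ix le_xy); rewrite ltnn.
- by rewrite -{1}(cat_take_drop i o) !precedes_catr.
Qed.

Lemma blocks_lo x y :
  x \in o -> index x o < i -> y \in lB ++ lF -> precedes M x y.
Proof.
move=> xo xi yl; apply: precedes_catlr; first by rewrite in_take.
apply: contraL yl => /mem_take yo; rewrite mem_cat negb_or.
by rewrite oB ?oF.
Qed.

Lemma blocks_hi x y :
  x \in lB ++ lF -> y \in o -> i <= index y o -> precedes M x y.
Proof.
move=> xl yo yi; rewrite /M precedes_catr.
- rewrite catA precedes_catlr // mem_cat negb_or oB ?oF //.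
- apply: contraL xl => /mem_take xo; rewrite mem_cat negb_or.
  by rewrite oB ?oF.
- by rewrite in_take // -leqNgt.
Qed.

Lemma blocks_notin_take x : x \in lB ++ lF -> x \notin take i o.
Proof.
by apply: contraL => /mem_take xo; rewrite mem_cat negb_or oB ?oF.
Qed.

Lemma blocks_BF x y : x \in lB -> y \in lF -> precedes M x y.
Proof.
move=> xB yF; rewrite /M precedes_catr ?blocks_notin_take ?mem_cat ?xB ?yF ?orbT //.
by rewrite precedes_catlr //; apply: contraL yF; apply: BF.
Qed.

Lemma blocks_B x y : x \in lB -> y \in lB -> precedes lB x y -> precedes M x y.
Proof.
move=> xB yB; rewrite /M precedes_catr ?blocks_notin_take ?mem_cat ?xB ?yB //.
by rewrite precedes_catl.
Qed.

Lemma blocks_F x y : x \in lF -> y \in lF -> precedes lF x y -> precedes M x y.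
Proof.
move=> xF yF.
rewrite /M precedes_catr ?blocks_notin_take ?mem_cat ?xF ?yF ?orbT //.
rewrite precedes_catr ?precedes_catl //.
- by apply: contraL xF; apply: BF.
- by apply: contraL yF; apply: BF.
Qed.

End Blocks.
End BlockOrder.

(** * The end of a search *)

Section Finished.
Variables (n : nat) (G : state n) (a : darc n) (E : seq (darc n)).
Variables (S : search n) (L : seq (darc n * darc n)).
Hypothesis iS : search_inv G a E S L.

Definition search_done : Prop := forall x y, x \in fwd S -> y \in bwd S ->
  outp S x <> [::] -> inp S y <> [::] -> ~~ before G x y.

(** By [sv_cross] only active and passive vertices matter. If one active set is empty, its passive
    set is empty too. Otherwise both active sets are reduced to the threshold, so what is held
    forward lies at or after it and what is held backward at or before it. *)
Lemma no_admissible_done :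
  (factive S = set0 -> fpassive S = set0) ->
  (bactive S = set0 -> bpassive S = set0) ->
  (forall u z, ~~ admissible S u z) -> search_done.
Proof.
move=> hF hB na x y xF yB ox iy; apply/negP => xy.
have [xA yA] := sv_cross iS xF yB ox iy xy.
case: (set_0Vmem (factive S)) => [F0|[u uA]].
  by move: xA; rewrite hF F0 // setU0 inE.
case: (set_0Vmem (bactive S)) => [B0|[z zA]].
  by move: yA; rewrite hB B0 // setU0 inE.
have adm u' z' : u' \in factive S -> z' \in bactive S ->
    u' = thr S /\ z' = thr S.
  move=> uA' zA'; have := na u' z'; rewrite /admissible uA' zA' /= negbK.
  by case/andP => /eqP-> /eqP->.
have sx : before_eq G (thr S) x.
  case/setUP: xA => [xA|/(sv_fpas iS)/ltnW//].
  by have [-> _] := adm x z xA zA; exact: leqnn.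
have ys : before_eq G y (thr S).
  case/setUP: yA => [yA|/(sv_bpas iS)/ltnW//].
  by have [_ ->] := adm u y uA yA; exact: leqnn.
by have := leq_trans (leq_trans xy ys) sx; rewrite ltnn.
Qed.

End Finished.

(** * The moved vertices and the component of the new arc *)

Section Update.
Variables (n : nat) (G : state n) (a : darc n) (E : seq (darc n)).
Variables (S : search n) (L : seq (darc n * darc n)).
Hypothesis iS : search_inv G a E S L.
Hypothesis done_S : search_done G S.

Let v := rep G a.1.
Let w := rep G a.2.
Let t := tvertex G a S.
Let wfG := sv_wf iS.

Lemma rep_v : rep G v = v. Proof. exact: wf_rep wfG _. Qed.
Lemma rep_w : rep G w = w. Proof. exact: wf_rep wfG _. Qed.

Lemma fwd_w : w \in fwd S. Proof. exact: side_root (sv_f iS). Qed.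
Lemma bwd_v : v \in bwd S. Proof. exact: side_root (sv_b iS). Qed.

Lemma tvertex_cases : t = v \/ t \in live S.
Proof.
rewrite /t /tvertex; case: arg_minnP => [|x]; first exact: setU11.
by case/setU1P => [->|]; [left|right].
Qed.

Lemma tvertex_min x : x \in v |: live S -> before_eq G t x.
Proof.
rewrite /t /tvertex; case: arg_minnP => [|y _]; first exact: setU11.
exact.
Qed.

Lemma tvertex_le_v : before_eq G t v.
Proof. by apply: tvertex_min; rewrite setU11. Qed.

Lemma tvertex_lt_v : t != v -> before G t v.
Proof.
move=> ne; rewrite /before ltn_neqAle -/(before_eq G t v) tvertex_le_v andbT.
apply: contraNneq ne => eq_tv; apply/eqP; apply: pos_inj wfG _ rep_v eq_tv.
case: tvertex_cases => [->|]; first exact: rep_v.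
by rewrite inE => /andP[/(side_rep (sv_f iS))].
Qed.

Lemma live_fwd x : x \in live S -> x \in fwd S.
Proof. by rewrite inE => /andP[]. Qed.

Lemma tvertex_fwd : t != v -> t \in fwd S.
Proof.
by move=> ne; case: tvertex_cases ne => [->|/live_fwd//]; rewrite eqxx.
Qed.

Lemma w_le_tvertex : before_eq G w t.
Proof.
case: (eqVneq t v) => [->|ne]; first exact: ltnW (sv_new iS).
exact: (sv_lo iS (tvertex_fwd ne)).
Qed.

Lemma rep_tvertex : rep G t = t.
Proof.
case: (eqVneq t v) => [->|ne]; first exact: rep_v.
exact: (side_rep (sv_f iS) (tvertex_fwd ne)).
Qed.

Lemma FltP x : x \in Flt G a S = (x \in fwd S) && before G x t.
Proof. by rewrite inE. Qed.
Lemma notin_Flt x : before_eq G t x -> x \notin Flt G a S.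
Proof. by move=> tx; rewrite FltP negb_and /before -leqNgt; apply/orP; right; exact: tx. Qed.
Lemma BgtP x : x \in Bgt G a S = (x \in bwd S) && before G t x.
Proof. by rewrite inE. Qed.

(** A forward vertex that is not exhausted is live, hence not before the minimum [t]. *)
Lemma Flt_exhausted x : x \in Flt G a S -> outp S x = [::].
Proof.
rewrite FltP => /andP[xF xt]; case e: (outp S x) => [//|b s].
have : before_eq G t x by apply: tvertex_min; rewrite !inE xF e orbT.
by rewrite /before_eq leqNgt -/(before G x t) xt.
Qed.

(** No vertex of B lies after [v], which settles [t = v]. Otherwise [t] is a live forward vertex,
    and [search_done] excludes a live backward vertex after it. *)
Lemma Bgt_exhausted y : y \in Bgt G a S -> inp S y = [::].
Proof.
rewrite BgtP => /andP[yB ty]; case e: (inp S y) => [//|b s].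
case: tvertex_cases => [etv|tl].
  have := sv_hi iS yB; rewrite -/v -etv /before_eq leqNgt.
  by rewrite -/(before G t y) ty.
have := done_S (live_fwd tl) yB; rewrite ty e; move: tl; rewrite inE.
by case/andP => _; case: (outp S t) => // c s' _; case.
Qed.

Lemma Bgt_empty : t = v -> Bgt G a S = set0.
Proof.
move=> etv; apply/setP => y; rewrite BgtP inE etv.
case: (boolP (y \in bwd S)) => //= /(sv_hi iS).
by rewrite -/v /before_eq /before leqNgt => /negPf->.
Qed.

Lemma Bgt_v : t != v -> v \in Bgt G a S.
Proof. by move=> ne; rewrite BgtP bwd_v tvertex_lt_v. Qed.

Lemma rep_Flt x : x \in Flt G a S -> rep G x = x.
Proof. by rewrite FltP => /andP[/(side_rep (sv_f iS))]. Qed.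
Lemma rep_Bgt x : x \in Bgt G a S -> rep G x = x.
Proof. by rewrite BgtP => /andP[/(side_rep (sv_b iS))]. Qed.

Lemma Xset_cases x :
  x \in Xset G a S = [|| x \in Flt G a S, x == t | x \in Bgt G a S].
Proof. by rewrite !in_setU in_set1 orbA. Qed.

Lemma v_Xset : v \in Xset G a S.
Proof.
rewrite Xset_cases; case: (eqVneq t v) => [etv|ne].
  by rewrite orbT.
by rewrite Bgt_v // !orbT.
Qed.

Lemma Flt_Bgt_disjoint x : x \in Flt G a S -> x \notin Bgt G a S.
Proof.
by rewrite FltP BgtP negb_and /before => /andP[_ xt]; rewrite -leqNgt ltnW ?orbT.
Qed.

Lemma Flt_neq_t x : x \in Flt G a S -> x != t.
Proof.
by rewrite FltP => /andP[_ xt]; apply/eqP => ex; move: xt; rewrite ex /before ltnn.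
Qed.

Lemma Bgt_neq_t x : x \in Bgt G a S -> x != t.
Proof.
by rewrite BgtP => /andP[_ xt]; apply/eqP => ex; move: xt; rewrite ex /before ltnn.
Qed.

Lemma new_arc_Yarcs : (v, w) \in Yarcs G a S.
Proof. exact: mem_head. Qed.

Lemma scanned_Yarcs b : b \in scanned G a S -> rep G b.1 != rep G b.2 ->
  (rep G b.1, rep G b.2) \in Yarcs G a S.
Proof.
move=> bs nb; rewrite inE mem_filter nb /=; apply/orP; right.
by apply/mapP; exists b.
Qed.

Lemma Yarcs_cases x y : (x, y) \in Yarcs G a S ->
  exists b, [/\ b \in a :: E, rep G b.1 = x & rep G b.2 = y].
Proof.
rewrite inE => /orP[/eqP[-> ->]|].
  by exists a; rewrite mem_head.
rewrite mem_filter => /andP[_ /mapP[b bs [-> ->]]]; exists b; split=> //.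
move: bs; rewrite mem_cat => /orP[]/flattenP[l /mapP[x' _ ->]].
- by case/(lists_sound (wf_outs wfG)).
- by case/(lists_sound (wf_ins wfG)).
Qed.

(** The pointer of the tail is exhausted, so its whole list has been traversed and all heads have
    been visited. *)
Lemma Flt_arc b : b \in a :: E -> rep G b.1 \in Flt G a S ->
  rep G b.1 != rep G b.2 ->
  rep G b.2 \in fwd S /\ (rep G b.1, rep G b.2) \in Yarcs G a S.
Proof.
move=> bE bF nb; have bo := lists_complete (wf_outs wfG) bE nb.
have := side_list (sv_f iS) _ bo; rewrite (Flt_exhausted bF) in_nil orbF.
move: (bF); rewrite FltP => /andP[b1F _] /(_ b1F) /(side_tr (sv_f iS))[_ _ b2F _].
split=> //; apply: scanned_Yarcs nb; rewrite mem_cat; apply/orP; left.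
by apply/flattenP; exists (outs G (rep G b.1)) => //; rewrite map_f // mem_enum.
Qed.

Lemma Bgt_arc b : b \in a :: E -> rep G b.2 \in Bgt G a S ->
  rep G b.1 != rep G b.2 ->
  rep G b.1 \in bwd S /\ (rep G b.1, rep G b.2) \in Yarcs G a S.
Proof.
move=> bE bF nb; have bo := lists_complete (wf_ins wfG) bE nb.
have := side_list (sv_b iS) _ bo; rewrite (Bgt_exhausted bF) in_nil orbF.
move: (bF); rewrite BgtP => /andP[b1F _] /(_ b1F) /(side_tr (sv_b iS))[_ _ b2F _].
split=> //; apply: scanned_Yarcs nb; rewrite mem_cat; apply/orP; right.
by apply/flattenP; exists (ins G (rep G b.2)) => //; rewrite map_f // mem_enum.
Qed.

Lemma old_arc_lt b : b \in E -> rep G b.1 != rep G b.2 ->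
  before G (rep G b.1) (rep G b.2).
Proof.
move=> bE nb; rewrite /before ltn_neqAle (sv_sorted iS bE) andbT.
by apply: contraNneq nb => /(pos_inj wfG (wf_rep wfG _) (wf_rep wfG _)) ->.
Qed.

Lemma fwd_Xset x : x \in fwd S -> before_eq G x t -> x \in Xset G a S.
Proof.
move=> xF; rewrite /before_eq leq_eqVlt => /orP[/eqP|] xt.
  rewrite Xset_cases; apply/or3P/Or32; apply/eqP.
  exact: (pos_inj wfG (side_rep (sv_f iS) xF) rep_tvertex).
by rewrite Xset_cases FltP xF /before xt.
Qed.

Let Y := Yrel G a S.

Lemma connect_vw : connect Y v w.
Proof.
apply: connect1; rewrite /Y /Yrel v_Xset new_arc_Yarcs andbT /=.
exact: fwd_Xset fwd_w w_le_tvertex.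
Qed.

(** The order makes the induction well founded: the arc by which [x] was reached is old, as the new
    one leads to [w], so its tail lies strictly earlier. That tail is in F_<, hence the arc is in
    Y. *)
Lemma connect_v_fwd x : x \in fwd S -> before_eq G x t -> connect Y v x.
Proof.
have [k] := ubnP (pos G x); elim: k x => // k IHk x xk xF xt.
case: (eqVneq x w) => [->|/eqP nxw]; first exact: connect_vw.
have [b [bE b2 b1F nb]] := side_pred (sv_f iS) xF nxw.
have b12 : rep G b.1 != rep G b.2 by rewrite b2.
have bE' : b \in E.
  by move: bE; rewrite inE => /orP[/eqP eb|//]; case: nxw; rewrite -b2 eb.
have lt_bx := old_arc_lt bE' b12; rewrite b2 in lt_bx.
have bF : rep G b.1 \in Flt G a S.
  by rewrite FltP b1F; exact: leq_trans lt_bx xt.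
have b1t : before_eq G (rep G b.1) t by exact: ltnW (leq_trans lt_bx xt).
apply: connect_trans (IHk _ (leq_trans lt_bx xk) b1F b1t) _.
apply: connect1; have [_ bY] := Flt_arc bE bF b12; rewrite b2 in bY.
by rewrite /Y /Yrel bY !fwd_Xset.
Qed.

Lemma Bgt_pred x : x \in Bgt G a S -> x <> v -> exists2 y,
  y \in Bgt G a S & before G x y /\ (x, y) \in Yarcs G a S.
Proof.
move=> xG nxv; move: (xG); rewrite BgtP => /andP[xB tx].
have [b [bE b1 b2B nb]] := side_pred (sv_b iS) xB nxv.
have b12 : rep G b.1 != rep G b.2 by rewrite b1 eq_sym.
have bE' : b \in E.
  by move: bE; rewrite inE => /orP[/eqP eb|//]; case: nxv; rewrite -b1 eb.
have lt_bx := old_arc_lt bE' b12; rewrite b1 in lt_bx.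
have bG : rep G b.2 \in Bgt G a S.
  by rewrite BgtP b2B; exact: ltn_trans tx lt_bx.
exists (rep G b.2) => //; split=> //.
by have [_] := Bgt_arc bE bG b12; rewrite b1.
Qed.

(** From any vertex of B_> other than [v], [Bgt_pred] climbs to a later one, so the climb ends at
    [v]. *)
Lemma Bgt_ind (P : 'I_n -> Prop) : P v ->
  (forall x y, x \in Bgt G a S -> y \in Bgt G a S ->
     (x, y) \in Yarcs G a S -> P y -> P x) ->
  forall x, x \in Bgt G a S -> P x.
Proof.
move=> Pv Pstep x; have [k] := ubnP (size (toporder G) - pos G x).
elim: k x => // k IHk x xk xG.
case: (eqVneq x v) => [->//|/eqP nxv].
have [y yG [xy xyY]] := Bgt_pred xG nxv.
apply: (Pstep _ y) => //; apply: IHk (yG).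
have : pos G y < size (toporder G).
  by rewrite index_mem (wf_mem wfG) (rep_Bgt yG).
by move: xy xk; rewrite /before /pos; lia.
Qed.

Lemma Bgt_Xset x : x \in Bgt G a S -> x \in Xset G a S.
Proof. by move=> xG; rewrite Xset_cases xG !orbT. Qed.

Lemma connect_Bgt_v x : x \in Bgt G a S -> connect Y x v.
Proof.
move: x; apply: Bgt_ind => // x y xG yG xyY; apply: connect_trans.
by apply: connect1; rewrite /Y /Yrel !Bgt_Xset.
Qed.

Let C := component G a S.

Lemma mem_component x :
  x \in C = [&& x \in Xset G a S, connect Y v x & connect Y x v].
Proof. by rewrite inE. Qed.

Lemma v_component : v \in C.
Proof. by rewrite mem_component v_Xset connect0. Qed.

(** Since [v] already reaches [x] by [connect_v_fwd], only a way back to [v] is missing, and it goes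
    through [y]. Dually, [component_succ] rests on [connect_Bgt_v]. *)
Lemma component_pred x y : x \in fwd S -> before_eq G x t ->
  (x, y) \in Yarcs G a S -> y \in C -> x \in C.
Proof.
move=> xF xt xyY; rewrite !mem_component => /and3P[yX _ yv].
rewrite fwd_Xset // connect_v_fwd //=; apply: connect_trans yv.
by apply: connect1; rewrite /Y /Yrel fwd_Xset // yX.
Qed.

Lemma component_succ x y : y \in Bgt G a S ->
  (x, y) \in Yarcs G a S -> x \in C -> y \in C.
Proof.
move=> yG xyY; rewrite !mem_component => /and3P[xX vx _].
rewrite Bgt_Xset // connect_Bgt_v // andbT; apply: connect_trans vx _.
by apply: connect1; rewrite /Y /Yrel (Bgt_Xset yG) xX.
Qed.

(** * The new order is topological *)

Section NewOrder.
Variables lF lB : seq 'I_n.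
Hypothesis lF_top : topological_listing G a S (Flt G a S) lF.
Hypothesis lB_top : topological_listing G a S (Bgt G a S) lB.
Let M := reorder G a S lF lB.
Let o := [seq x <- toporder G | x \notin Flt G a S :|: Bgt G a S].
Let i := if t == v then (index t o).+1 else index t o.

Lemma mem_lF x : x \in lF = (x \in Flt G a S).
Proof. by case/andP: lF_top => /perm_mem-> _; rewrite mem_enum. Qed.
Lemma mem_lB x : x \in lB = (x \in Bgt G a S).
Proof. by case/andP: lB_top => /perm_mem-> _; rewrite mem_enum. Qed.

Lemma mem_o x : x \in o = [&& rep G x == x, x \notin Flt G a S & x \notin Bgt G a S].
Proof. by rewrite mem_filter inE negb_or (wf_mem wfG) andbC. Qed.

(** For [t = v] the block of B_> is empty, so the two kinds of reordering differ only in the place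
    [i] of the cut. *)
Lemma reorderE : M = take i o ++ lB ++ lF ++ drop i o.
Proof.
rewrite /M /reorder /i -/t -/v; case: eqVneq => // etv.
have lB0 : lB = [::].
  by case/andP: lB_top; rewrite Bgt_empty // enum_set0 => /perm_nilP.
by rewrite lB0 /o (Bgt_empty etv) setU0.
Qed.

Lemma topological_precedes (A : {set 'I_n}) l x y :
  topological_listing G a S A l -> x \in l -> y \in l ->
  (x, y) \in Yarcs G a S -> precedes l x y.
Proof.
case/andP => _ /allP tl xl yl /tl /=; rewrite xl yl /=; exact: ltnW.
Qed.

Let oB x : x \in o -> x \notin lB.
Proof. by rewrite mem_o mem_lB => /and3P[]. Qed.
Let oF x : x \in o -> x \notin lF.
Proof. by rewrite mem_o mem_lF => /and3P[]. Qed.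
Let BF x : x \in lB -> x \notin lF.
Proof. by rewrite mem_lF mem_lB; apply: contraL; apply: Flt_Bgt_disjoint. Qed.

Lemma order_old x y : x \in o -> y \in o -> before_eq G x y -> precedes M x y.
Proof.
move=> xo yo xy; rewrite reorderE; apply: blocks_old => //.
by apply: index_filter_le => //; move: xo; rewrite mem_filter => /andP[].
Qed.

Lemma t_notin : t \notin Flt G a S :|: Bgt G a S.
Proof.
by rewrite inE negb_or; apply/andP; split; apply/negP;
   [move/Flt_neq_t|move/Bgt_neq_t]; rewrite eqxx.
Qed.

(** The vertex [t] itself comes before the moved blocks if it is [v] and after them otherwise; hence
    the third hypothesis here and in [order_hi]. *)
Lemma order_lo x y : x \in o -> before_eq G x t -> (t != v -> x != t) ->
  y \in Flt G a S :|: Bgt G a S -> precedes M x y.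
Proof.
move=> xo xt ne yl; rewrite reorderE; apply: blocks_lo => //; last first.
  by rewrite mem_cat mem_lF mem_lB orbC -in_setU.
have xP : x \notin Flt G a S :|: Bgt G a S.
  by move: xo; rewrite mem_filter => /andP[].
rewrite /i; case: eqVneq => [_|/ne nxt]; first by rewrite ltnS index_filter_le.
apply: index_filter_lt => //; rewrite ltn_neqAle -/(before_eq G x t) xt andbT.
apply: contraNneq nxt => eq_xt; apply/eqP; apply: pos_inj wfG _ rep_tvertex eq_xt.
by move: xo; rewrite mem_o => /andP[/eqP].
Qed.

Lemma order_hi x y : y \in o -> before_eq G t y -> (t = v -> y != t) ->
  x \in Flt G a S :|: Bgt G a S -> precedes M x y.
Proof.
move=> yo ty ne xl; rewrite reorderE; apply: blocks_hi => //.
  by rewrite mem_cat mem_lF mem_lB orbC -in_setU.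
rewrite /i; case: eqVneq => [/ne nyt|_]; last by rewrite index_filter_le ?t_notin.
apply: index_filter_lt; last exact: t_notin.
rewrite ltn_neqAle -/(before_eq G t y) ty andbT.
apply: contraNneq nyt => eq_ty; apply/eqP/esym; apply: pos_inj wfG rep_tvertex _ eq_ty.
by move: yo; rewrite mem_o => /andP[/eqP].
Qed.

Lemma order_BF x y : x \in Bgt G a S -> y \in Flt G a S -> precedes M x y.
Proof. by move=> xB yF; rewrite reorderE; apply: blocks_BF; rewrite ?mem_lB ?mem_lF. Qed.

Lemma order_B x y : x \in Bgt G a S -> y \in Bgt G a S ->
  (x, y) \in Yarcs G a S -> precedes M x y.
Proof.
move=> xB yB xy; rewrite reorderE; apply: blocks_B; rewrite ?mem_lB //.
by apply: topological_precedes lB_top _ _ xy; rewrite mem_lB.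
Qed.

Lemma order_F x y : x \in Flt G a S -> y \in Flt G a S ->
  (x, y) \in Yarcs G a S -> precedes M x y.
Proof.
move=> xF yF xy; rewrite reorderE; apply: blocks_F; rewrite ?mem_lF //.
by apply: topological_precedes lF_top _ _ xy; rewrite mem_lF.
Qed.

Lemma order_B_v x : x \in Bgt G a S -> precedes M x v.
Proof.
move: x; apply: Bgt_ind; first exact: leqnn.
by move=> x y xB yB xy yv; apply: leq_trans (order_B xB yB xy) yv.
Qed.

(** This is [new_rep] on old canonical vertices. The order is checked in [M], before vertices that
    cease to be canonical are deleted; [index_filter_le] carries it over. *)
Let c x := if x \in C then v else x.

Lemma mem_o_rep x : x \notin Flt G a S -> x \notin Bgt G a S ->
  rep G x = x -> x \in o.
Proof. by rewrite mem_o => -> -> /eqP->. Qed.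

Lemma notin_component x : x \notin Flt G a S -> x \notin Bgt G a S ->
  x != t -> x \notin C.
Proof.
by rewrite mem_component Xset_cases => /negPf-> /negPf-> /negPf->.
Qed.

Lemma contract_id x : x \notin C -> c x = x.
Proof. by rewrite /c => /negPf->. Qed.

Lemma contractP x : c x = x \/ c x = v.
Proof. by rewrite /c; case: ifP; [right|left]. Qed.

Lemma before_neq x y : before G x y -> x != y.
Proof. by apply: contraTneq => ->; rewrite /before ltnn. Qed.

Lemma order_v_F y : t = v -> y \in Flt G a S -> precedes M v y.
Proof.
move=> etv yF; have vt : v \notin Flt G a S :|: Bgt G a S by rewrite -etv t_notin.
apply: order_lo.
- by rewrite mem_filter vt (wf_mem wfG) rep_v eqxx.
- by rewrite etv; exact: leqnn.
- by rewrite etv eqxx.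
- by rewrite inE yF.
Qed.

(** Only F_< moves, to just after [v], so the arcs at risk leave F_<. If the head is contracted, so
    is the tail, by [component_pred]; otherwise the head is in F_<, listed topologically, or stays
    beyond the block. *)
Lemma new_order_at_v b : t = v -> b \in E -> rep G b.1 != rep G b.2 ->
  precedes M (c (rep G b.1)) (c (rep G b.2)).
Proof.
move=> etv bE nb; have pq := old_arc_lt bE nb.
have bE' : b \in a :: E by rewrite inE bE orbT.
have rp := wf_rep wfG b.1; have rq := wf_rep wfG b.2.
have notB x : x \notin Bgt G a S by rewrite Bgt_empty ?inE.
have vF : v \notin Flt G a S by rewrite -etv; apply: contraTN isT => /Flt_neq_t/eqP.
have vo : v \in o by apply: mem_o_rep => //; apply: rep_v.
case: (boolP (rep G b.1 \in Flt G a S)) => pF.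
  have [qF pqY] := Flt_arc bE' pF nb.
  have /andP[pf pt] : (rep G b.1 \in fwd S) && before G (rep G b.1) t.
    by rewrite -FltP.
  case: (boolP (rep G b.2 \in C)) => qC.
    have pC := component_pred pf (ltnW pt) pqY qC.
    by rewrite /c pC qC; exact: leqnn.
  rewrite (contract_id qC).
  case: (boolP (rep G b.2 \in Flt G a S)) => qF'.
    case: (contractP (rep G b.1)) => ->; first exact: order_F.
    exact: order_v_F.
  have tq : before_eq G t (rep G b.2).
    by move: qF'; rewrite FltP qF /before -leqNgt.
  have qo : rep G b.2 \in o by apply: mem_o_rep.
  have nqt : rep G b.2 != t.
    by apply: contraNneq qC => ->; rewrite etv v_component.
  case: (contractP (rep G b.1)) => ->; last by apply: order_old => //; rewrite -etv.
  by apply: (order_hi qo tq) => //; rewrite in_setU pF.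
have po : rep G b.1 \in o by apply: mem_o_rep.
(* With B_> empty, the component consists of [v] and vertices of F_<. *)
have -> : c (rep G b.1) = rep G b.1.
  case: (eqVneq (rep G b.1) t) => [->|npt]; last exact/contract_id/notin_component.
  by rewrite etv /c v_component.
case: (boolP (rep G b.2 \in Flt G a S)) => qF.
  have pt : before_eq G (rep G b.1) t.
    by move: qF; rewrite FltP => /andP[_ qt]; exact: ltnW (ltn_trans pq qt).
  case: (contractP (rep G b.2)) => ->; last by apply: order_old => //; rewrite -etv.
  by apply: (order_lo po pt); [rewrite etv eqxx|rewrite in_setU qF].
have -> : c (rep G b.2) = rep G b.2.
  case: (eqVneq (rep G b.2) t) => [->|npt]; last exact/contract_id/notin_component.
  by rewrite etv /c v_component.
by apply: order_old => //; [apply: mem_o_rep|apply: ltnW].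
Qed.

(** The tail is in F_<, in B_>, equal to [t], or elsewhere. The move reverses exactly the arcs from
    F_< or [t] into B_>; each closes a cycle through the new arc, as [v] reaches its tail and its
    head reaches [v], so both its ends are contracted to [v]. *)
Lemma new_order_before_v b : t != v -> b \in E -> rep G b.1 != rep G b.2 ->
  precedes M (c (rep G b.1)) (c (rep G b.2)).
Proof.
move=> ntv bE nb; have pq := old_arc_lt bE nb.
have bE' : b \in a :: E by rewrite inE bE orbT.
have rp := wf_rep wfG b.1; have rq := wf_rep wfG b.2.
set p := rep G b.1 in pq nb rp *; set q := rep G b.2 in pq nb rq *.
have vB := Bgt_v ntv; have etv : t = v -> false by move=> e; rewrite e eqxx in ntv.
have tF := tvertex_fwd ntv.
have t_o : t \in o by rewrite mem_filter t_notin (wf_mem wfG) rep_tvertex eqxx.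
have dFB x : x \in Flt G a S -> x \in Flt G a S :|: Bgt G a S by move=> xF; rewrite inE xF.
have dBF x : x \in Bgt G a S -> x \in Flt G a S :|: Bgt G a S by move=> xF; rewrite inE xF orbT.
have past x y : x \in Flt G a S :|: Bgt G a S -> before_eq G t y ->
    y \notin Bgt G a S -> rep G y = y -> precedes M x y.
  move=> xl ty yB ry; apply: order_hi => // [|/etv//].
  by apply: mem_o_rep => //; apply: notin_Flt.
have pqB : q \in Bgt G a S -> p \in bwd S /\ (p, q) \in Yarcs G a S.
  by move=> qB; apply: Bgt_arc.
case: (boolP (p \in Flt G a S)) => pF.
  have [qF pqY] := Flt_arc bE' pF nb.
  have /andP[pf pt] : (p \in fwd S) && before G p t by rewrite -FltP.
  case: (boolP (q \in C)) => qC.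
    have pC := component_pred pf (ltnW pt) pqY qC.
    by rewrite /c pC qC; exact: leqnn.
  rewrite (contract_id qC).
  have qB : q \notin Bgt G a S.
    apply: contra qC => qB; rewrite mem_component Bgt_Xset // connect_Bgt_v // andbT.
    apply: connect_trans (connect_v_fwd pf (ltnW pt)) _; apply: connect1.
    by rewrite /Y /Yrel pqY (Bgt_Xset qB) fwd_Xset // /before_eq ltnW.
  case: (boolP (q \in Flt G a S)) => qF'.
    by case: (contractP p) => ->; [exact: order_F|exact: order_BF].
  have tq : before_eq G t q by move: qF'; rewrite FltP qF /before -leqNgt.
  by case: (contractP p) => ->; apply: past; auto.
case: (boolP (p \in Bgt G a S)) => pB.
  have tq : before G t q.
    by move: pB; rewrite BgtP => /andP[_ tp]; exact: ltn_trans tp pq.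
  case: (boolP (q \in Bgt G a S)) => qB; last first.
    rewrite (contract_id (notin_component _ qB _)).
    - by case: (contractP p) => ->; apply: past; auto; exact: ltnW.
    - by apply: notin_Flt; exact: ltnW.
    - by rewrite eq_sym before_neq.
  have [_ pqY] := pqB qB.
  case: (boolP (p \in C)) => pC.
    by rewrite /c pC (component_succ qB pqY pC); exact: leqnn.
  by rewrite (contract_id pC); case: (contractP q) => ->; [exact: order_B|exact: order_B_v].
have po : p \in o by apply: mem_o_rep.
case: (eqVneq p t) => [ept|npt].
  case: (boolP (q \in Bgt G a S)) => qB.
    have [_ pqY] := pqB qB.
    have qC : q \in C.
      rewrite mem_component Bgt_Xset // connect_Bgt_v // andbT.
      have tt : before_eq G t t by exact: leqnn.
      rewrite ept in pqY; apply: connect_trans (connect_v_fwd tF tt) _.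
      by apply: connect1; rewrite /Y /Yrel pqY (Bgt_Xset qB) fwd_Xset.
    have pC : p \in C.
      by apply: (component_pred _ _ pqY qC); rewrite ept //; exact: leqnn.
    by rewrite /c pC qC; exact: leqnn.
  have tq : before_eq G t q by rewrite -ept; exact: ltnW.
  have qF : q \notin Flt G a S by apply: notin_Flt.
  have nqt : q != t by rewrite -ept eq_sym.
  rewrite (contract_id (notin_component qF qB nqt)); case: (contractP p) => ->.
    by apply: order_old; [|exact: mem_o_rep|exact: ltnW].
  by apply: past; auto.
rewrite (contract_id (notin_component pF pB npt)).
case: (leqP (pos G p) (pos G t)) => pt.
  have lo y : y \in Flt G a S :|: Bgt G a S -> precedes M p y by apply: order_lo.
  case: (boolP (q \in Flt G a S :|: Bgt G a S)) => ql.
    by case: (contractP q) => ->; auto.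
  case: (contractP q) => ->; auto.
  apply: order_old => //; last exact: ltnW.
  by move: ql; rewrite inE negb_or => /andP[qF qB]; apply: mem_o_rep.
have tq : before G t q by exact: ltn_trans pt pq.
have qF : q \notin Flt G a S by apply: notin_Flt; exact: ltnW.
(* Otherwise the backward search would have visited [p], which lies after [t], and [p] would be in
   B_>. *)
have qB : q \notin Bgt G a S.
  apply: contra pB => /pqB[pb _]; by rewrite BgtP pb.
have nqt : q != t by rewrite eq_sym before_neq.
rewrite (contract_id (notin_component qF qB nqt)).
by apply: order_old => //; [apply: mem_o_rep|apply: ltnW].
Qed.

(** If [w] is not contracted, either it is in F_<, which is placed after [v], or it is [t], before
    which [v] is moved as an element of B_>. *)
Lemma new_order_new_arc : precedes M (c v) (c w).
Proof.
rewrite {1}/c v_component; case: (boolP (w \in C)) => wC.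
  by rewrite /c wC; exact: leqnn.
rewrite (contract_id wC); case: (boolP (w \in Flt G a S)) => wF.
  case: (eqVneq t v) => [etv|ntv]; last exact: order_BF (Bgt_v ntv) wF.
  exact: order_v_F.
have wt : w = t.
  have := w_le_tvertex; rewrite /before_eq leq_eqVlt => /orP[/eqP|wt].
    by apply: (pos_inj wfG) => //; [apply: rep_w|apply: rep_tvertex].
  by move: wF; rewrite FltP fwd_w /before wt.
case: (eqVneq t v) => [etv|ntv]; first by rewrite wt etv v_component in wC.
rewrite wt; apply: order_hi.
- by rewrite mem_filter t_notin (wf_mem wfG) rep_tvertex eqxx.
- exact: leqnn.
- by move=> etv; rewrite etv eqxx in ntv.
- by rewrite in_setU Bgt_v // orbT.
Qed.

Lemma new_order b : b \in a :: E -> precedes M (c (rep G b.1)) (c (rep G b.2)).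
Proof.
rewrite inE => /orP[/eqP->|bE]; first exact: new_order_new_arc.
case: (eqVneq (rep G b.1) (rep G b.2)) => [->|nb]; first exact: leqnn.
case: (eqVneq t v) => [etv|ntv]; first exact: new_order_at_v.
exact: new_order_before_v.
Qed.

End NewOrder.

(** * Time of the update *)

Lemma flatten_lists_uniq rp E' key l s : lists_ok rp E' key l -> uniq s ->
  uniq (flatten [seq l x | x : 'I_n <- s]).
Proof.
move=> lok; elim: s => //= x s IHs /andP[xs us].
rewrite cat_uniq (lists_uniq lok) IHs // andbT /=.
apply/hasPn => b /flattenP[_ /mapP[y ys ->]] by_; apply/negP => bx.
have [_ kx] := lists_sound lok bx; have [_ ky] := lists_sound lok by_.
by rewrite -kx ky ys in xs.
Qed.

(** The scanned lists belong to exhausted vertices, so their arcs, all distinct, occur in the trace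
    of their direction. *)
Lemma size_scanned : size (scanned G a S) <= (size L).*2.
Proof.
rewrite size_cat -addnn -{1}(size_map fst L) -(size_map snd L).
apply: leq_add; apply: uniq_leq_size.
- exact: flatten_lists_uniq (wf_outs wfG) (enum_uniq _).
- move=> b /flattenP[_ /mapP[x + ->]] bx; rewrite mem_enum => xF.
  have := side_list (sv_f iS) _ bx; rewrite (Flt_exhausted xF) in_nil orbF.
  by apply; move: xF; rewrite FltP => /andP[].
- exact: flatten_lists_uniq (wf_ins wfG) (enum_uniq _).
- move=> b /flattenP[_ /mapP[x + ->]] bx; rewrite mem_enum => xB.
  have := side_list (sv_b iS) _ bx; rewrite (Bgt_exhausted xB) in_nil orbF.
  by apply; move: xB; rewrite BgtP => /andP[].
Qed.

(** With k traversals, the five summands of [update_time] are at most 2k + 2, 2k, (2k + 3) + (2k +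
    1), 2k + 3 and 2k + 2. *)
Lemma update_time_le : update_time G a S <= 12 * size L + 11.
Proof.
have cF := side_size (sv_f iS); have cB := side_size (sv_b iS).
rewrite !size_map in cF cB.
have sF : #|Flt G a S| <= #|fwd S|.
  by apply/subset_leq_card/subsetP => x; rewrite FltP => /andP[].
have sB : #|Bgt G a S| <= #|bwd S|.
  by apply/subset_leq_card/subsetP => x; rewrite BgtP => /andP[].
have sX : #|Xset G a S| <= #|Flt G a S| + 1 + #|Bgt G a S|.
  apply: leq_trans (leq_card_setU _ _) _; rewrite leq_add2r.
  by apply: leq_trans (leq_card_setU _ _) _; rewrite cards1.
have sC : #|component G a S| <= #|Xset G a S|.
  by apply/subset_leq_card/subsetP => x; rewrite mem_component => /andP[].
have sY : size (Yarcs G a S) <= (size (scanned G a S)).+1.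
  by rewrite /= ltnS size_filter (leq_trans (count_size _ _)) // size_map.
have := size_scanned; rewrite /update_time; lia.
Qed.

(** * The state after the update *)

Section NewState.
Variables lF lB ko ki : seq 'I_n.
Hypothesis lF_top : topological_listing G a S (Flt G a S) lF.
Hypothesis lB_top : topological_listing G a S (Bgt G a S) lB.
Hypothesis ko_perm : perm_eq ko (enum (component G a S)).
Hypothesis ki_perm : perm_eq ki (enum (component G a S)).
Let G' := new_state G a S lF lB ko ki.

Lemma new_repE x : rep G' x = if rep G x \in C then v else rep G x.
Proof. by []. Qed.

Lemma perm_reorder : perm_eq (reorder G a S lF lB) (toporder G).
Proof.
set o := [seq x <- toporder G | x \notin Flt G a S :|: Bgt G a S].
have perm_o : perm_eq (reorder G a S lF lB) (o ++ lB ++ lF).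
  rewrite (reorderE lF lB_top) -/o; set i := if _ then _ else _.
  apply: (@perm_trans _ ((take i o ++ drop i o) ++ lB ++ lF)).
    by rewrite -catA perm_cat2l perm_sym perm_catC -catA.
  by rewrite cat_take_drop.
apply: perm_trans perm_o _; apply: uniq_perm.
- rewrite !cat_uniq filter_uniq ?(wf_uniq wfG) //=.
  case/andP: (lF_top) => /perm_uniq-> _; case/andP: (lB_top) => /perm_uniq-> _.
  rewrite !enum_uniq andbT /=; apply/andP; split.
    apply/hasPn => x; rewrite mem_cat (mem_lB lB_top) (mem_lF lF_top) => xl.
    by rewrite /= mem_filter in_setU orbC xl.
  apply/hasPn => x; rewrite (mem_lF lF_top) /= (mem_lB lB_top).
  exact: Flt_Bgt_disjoint.
- exact: wf_uniq wfG.
move=> x; rewrite !mem_cat mem_filter (mem_lB lB_top) (mem_lF lF_top) in_setU.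
rewrite (wf_mem wfG); case: (boolP (x \in Flt G a S)) => xF.
  by rewrite (rep_Flt xF) eqxx !orbT.
case: (boolP (x \in Bgt G a S)) => xB; last by rewrite /= orbF.
by rewrite (rep_Bgt xB) eqxx orbT.
Qed.

Lemma lists_ok_contract key l k :
  lists_ok (rep G) (a :: E) key l -> perm_eq k (enum C) ->
  lists_ok (rep G') (a :: E) key
    (fun x => if x == v then flatten [seq l y | y <- k]
              else if x \in C then [::] else l x).
Proof.
move=> lok kC; split=> [x|x b|b bE nb].
- case: eqP => _; last by case: ifP => // _; apply: (lists_uniq lok).
  by apply: flatten_lists_uniq lok _; rewrite (perm_uniq kC) enum_uniq.
- case: eqP => [->|/eqP nx]; last first.
    case: ifP => // xC /(lists_sound lok)[-> kb]; split=> //.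
    by rewrite new_repE kb xC.
  move=> /flattenP[_ /mapP[y + ->]] /(lists_sound lok)[-> kb].
  by rewrite (perm_mem kC) mem_enum new_repE kb => ->.
have bl : b \in l (rep G (key b)).
  apply: (lists_complete lok) => //; apply: contraNneq nb.
  by rewrite !new_repE => ->.
rewrite new_repE; case: (boolP (rep G (key b) \in C)) => kC'.
  rewrite eqxx; apply/flattenP; exists (l (rep G (key b))) => //.
  by rewrite map_f // (perm_mem kC) mem_enum.
case: eqP => [ev|_] //; last by rewrite (negPf kC').
by rewrite ev v_component in kC'.
Qed.

Lemma new_state_wf : wf G' (a :: E).
Proof.
have rK := wf_rep wfG.
have rK' x : rep G' (rep G' x) = rep G' x.
  rewrite !new_repE; case: (boolP (rep G x \in C)) => xC.
    by rewrite rep_v v_component.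
  by rewrite rK (negPf xC).
(* Arcs of Y join canonical vertices; the underlying arcs are linked up inside the components by
   [wf_connect]. *)
have Yc x y : connect Y x y -> connect (arc_rel (a :: E)) x y.
  apply: connect_sub => {}x {}y /and3P[_ _ /Yarcs_cases[b [bE <- <-]]].
  apply: (@connect_trans _ _ b.1); first by apply: (wf_connect wfG).
  apply: (@connect_trans _ _ b.2); last by apply: (wf_connect wfG); rewrite rK.
  by apply: connect1; rewrite /arc_rel -surjective_pairing.
have rc x : connect (arc_rel (a :: E)) x (rep G x).
  by apply: (wf_connect wfG); rewrite rK.
have cr x : connect (arc_rel (a :: E)) (rep G x) x.
  by apply: (wf_connect wfG); rewrite rK.
split=> //.
- by rewrite filter_uniq // (perm_uniq perm_reorder) (wf_uniq wfG).
- move=> x; rewrite mem_filter (perm_mem perm_reorder) (wf_mem wfG).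
  rewrite -/(rep G' x); case: eqP => //= ex; apply/eqP.
  have : rep G (rep G' x) = rep G' x.
    by rewrite new_repE; case: ifP => _; [exact: rep_v|exact: rK].
  by rewrite [rep G' x]ex.
- move=> x y; rewrite !new_repE.
  have nv z : rep G z \notin C -> rep G z <> v.
    by move=> + ez; rewrite ez v_component.
  case: (boolP (rep G x \in C)) => xC; case: (boolP (rep G y \in C)) => yC.
  + move=> _; move: xC yC; rewrite !mem_component => /and3P[_ _ xv] /and3P[_ vy _].
    apply: connect_trans (rc x) (connect_trans (Yc _ _ xv) _).
    exact: connect_trans (Yc _ _ vy) (cr y).
  + by move=> /esym/(nv _ yC).
  + by move=> /(nv _ xC).
  + exact: (wf_connect wfG).
- exact: lists_ok_contract (wf_outs wfG) ko_perm.
- exact: lists_ok_contract (wf_ins wfG) ki_perm.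
Qed.

Lemma new_state_sorted : sorted_arcs G' (a :: E).
Proof.
move=> b bE; apply: index_filter_le; first exact: (new_order lF_top lB_top bE).
by apply/eqP; exact: (wf_rep new_state_wf).
Qed.

End NewState.
End Update.

(** * Amortization of the threshold selections *)

Section Phi.
Variables (n : nat) (lt : rel 'I_n).
Implicit Types (A P : {set 'I_n}) (s x u : 'I_n).

(* With A active, P passive and threshold s: until the next choice on this side,
   either the active vertices before s are all exhausted or P is dropped, so
   only the larger of the two sets is worth its full weight. *)
Definition phi s A P : nat :=
  maxn #|[set x in A | lt x s]| #|P| + #|[set x in A | lt s x]|.

Lemma phi_le s A A' P x : A' \subset x |: A -> phi s A' P <= phi s A P + 2.
Proof.
move=> sA; have bound (Q : pred 'I_n) :
    #|[set y in A' | Q y]| <= #|[set y in A | Q y]| + 1.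
  have sQ : [set y in A' | Q y] \subset x |: [set y in A | Q y].
    apply/subsetP => y; rewrite !inE => /andP[/(subsetP sA)].
    by rewrite !inE => /orP[->//|->] ->; rewrite orbT.
  apply: leq_trans (subset_leq_card sQ) _.
  by rewrite cardsU1 addnC leq_add2l leq_b1.
rewrite /phi; have /= := bound (fun y => lt y s).
have /= := bound (fun y => lt s y); lia.
Qed.

(** One unit leaves the last summand, and the maximum grows by at most one. *)
Lemma phi_passive s A P u : u \in A -> lt s u ->
  phi s (A :\ u) (u |: P) <= phi s A P.
Proof.
move=> uA su.
have lo : #|[set x in A :\ u | lt x s]| <= #|[set x in A | lt x s]|.
  by apply/subset_leq_card/subsetP => x; rewrite !inE -andbA => /andP[].
have hi : #|[set x in A | lt s x]| = (#|[set x in A :\ u | lt s x]|).+1.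
  rewrite (cardsD1 u) inE uA su add1n; congr _.+1; apply: eq_card => x.
  by rewrite !inE andbA.
have hP : #|u |: P| <= #|P| + 1 by rewrite cardsU1 addnC leq_add2l leq_b1.
rewrite /phi hi addnS -addSn leq_add2r geq_max.
by rewrite ltnW ?ltnS ?(leq_trans lo) ?leq_maxl // (leq_trans hP) // addn1 ltnS leq_maxr.
Qed.

Lemma phi_clear s A P : phi s (A :\ s) set0 <= phi s A P.
Proof.
rewrite /phi cards0 maxn0 leq_add //.
  apply: leq_trans (leq_maxl _ _); apply/subset_leq_card/subsetP => x.
  by rewrite !inE -andbA => /andP[].
by apply/subset_leq_card/subsetP => x; rewrite !inE -andbA => /andP[].
Qed.

Lemma phi_set0 s P : phi s set0 P = #|P|.
Proof.
have e Q : [set x in set0 | Q x] = set0 :> {set 'I_n}.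
  by apply/setP => x; rewrite !inE.
by rewrite /phi !e cards0 max0n addn0.
Qed.

(** This serves the side opposite to a choice: its passive set is dropped and, as the threshold is
    about to change, [phi] gives way to a plain count of active vertices. [phi_le_card] leads back
    to [phi] at the new threshold. *)
Lemma phi_drop s A P :
  (forall x, x \in A -> x != s -> lt x s || lt s x) -> #|A :\ s| <= phi s A P.
Proof.
move=> tot; have sA :
    A :\ s \subset [set x in A | lt x s] :|: [set x in A | lt s x].
  apply/subsetP => x; rewrite !inE => /andP[xs xA].
  by rewrite xA /= tot.
apply: leq_trans (subset_leq_card sA) (leq_trans (leq_card_setU _ _) _).
by rewrite leq_add2r leq_maxl.
Qed.

Hypothesis lt_asym : forall x y, lt x y -> ~~ lt y x.

Lemma phi_le_card s A : phi s A set0 <= #|A|.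
Proof.
rewrite /phi cards0 maxn0 -(cardsID [set x | lt x s] A) leq_add //.
  by apply/subset_leq_card/subsetP => x; rewrite !inE.
apply/subset_leq_card/subsetP => x; rewrite !inE => /andP[-> /lt_asym->].
by [].
Qed.

Definition pick_gain (le : rel 'I_n) P s : nat :=
  minn #|[set x in P | le x s]| #|[set x in P | le s x]|.

(** No active vertex is beyond the new threshold. The two terms of the maximum are at most |P| minus
    the number of elements at or after [s], and |P| minus the number at or before it. *)
Lemma phi_pick (le : rel 'I_n) s P :
  (forall x y, le x y = ~~ lt y x) ->
  phi s [set x in P | le x s] [set x in P | ~~ le x s] + pick_gain le P s
  <= #|P|.
Proof.
move=> leE; rewrite /phi /pick_gain.
have hi : #|[set x in [set x in P | le x s] | lt s x]| = 0.
  apply/eqP; rewrite cards_eq0; apply/eqP/setP => x; rewrite !inE leE.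
  by case: (lt s x); rewrite ?andbF.
have lo : #|[set x in [set x in P | le x s] | lt x s]| <= #|[set x in P | ~~ le s x]|.
  apply/subset_leq_card/subsetP => x; rewrite !inE !leE negbK.
  by case/andP => /andP[-> _] ->.
have split_card (Q : pred 'I_n) :
    #|P| = #|[set x in P | Q x]| + #|[set x in P | ~~ Q x]|.
  rewrite -(cardsID [set x | Q x] P); congr (_ + _); apply: eq_card => x;
  by rewrite !inE // andbC.
have /= := split_card (fun x => le x s).
have /= := split_card (fun x => le s x).
rewrite hi addn0; move: lo.
set l1 := #|[set x in P | le x s]|; set l2 := #|[set x in P | le s x]|.
set l3 := #|[set x in P | ~~ le x s]|; set l4 := #|[set x in P | ~~ le s x]|.
set l5 := #|[set x in [set x in P | le x s] | lt x s]|.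
set p := #|P|.
lia.
Qed.

End Phi.

(** * Ranks and the average gain of a random choice *)

Section Rank.
Variables (n : nat) (f : 'I_n -> nat) (A : {set 'I_n}).
Hypothesis f_inj : {in A &, injective f}.

Let rank s := #|[set x in A | f x <= f s]|.

Lemma rank_compl s : s \in A ->
  #|[set x in A | f s <= f x]| = #|A|.+1 - rank s.
Proof.
move=> sA; have := cardsID [set x | f x < f s] A.
have -> : A :\: [set x | f x < f s] = [set x in A | f s <= f x].
  by apply/setP => x; rewrite !inE -leqNgt andbC.
suff -> : rank s = (#|A :&: [set x | f x < f s]|).+1.
  by move=> <-; rewrite subSS addKn.
rewrite /rank (cardsD1 s) inE sA leqnn add1n; congr _.+1.
apply: eq_card => x; rewrite !inE ltn_neqAle.
case: (boolP (x \in A)) => xA; rewrite ?andbF //=; congr (_ && _).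
apply/idP/idP; first by apply: contraNneq => e; apply/eqP; apply: f_inj.
by apply: contraNneq => ->.
Qed.

Lemma rank_lt s s' : s' \in A -> f s < f s' -> rank s < rank s'.
Proof.
move=> s'A lt_ss; rewrite /rank [X in _ < X](cardsD1 s') inE s'A leqnn.
rewrite add1n ltnS; apply/subset_leq_card/subsetP => x; rewrite !inE.
case/andP => -> xs; rewrite (leq_trans xs (ltnW lt_ss)) !andbT.
by apply: contraTneq xs => ->; rewrite -ltnNge.
Qed.

Lemma rank_perm : perm_eq [seq rank s | s <- enum A] (iota 1 #|A|).
Proof.
have u : uniq [seq rank s | s <- enum A].
  rewrite map_inj_in_uniq ?enum_uniq // => s s'; rewrite !mem_enum => sA sA' e.
  apply: f_inj => //; case: (ltngtP (f s) (f s')) => // lt_ss.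
  - by have := rank_lt sA' lt_ss; rewrite e ltnn.
  - by have := rank_lt sA lt_ss; rewrite e ltnn.
have sub : {subset [seq rank s | s <- enum A] <= iota 1 #|A|}.
  move=> _ /mapP[s + ->]; rewrite mem_enum mem_iota add1n ltnS => sA.
  apply/andP; split.
    by apply/card_gt0P; exists s; rewrite inE sA leqnn.
  by apply/subset_leq_card/subsetP => x; rewrite inE => /andP[].
apply: uniq_perm => //; first exact: iota_uniq.
by have [] := uniq_min_size u sub; rewrite // size_map size_iota -cardE.
Qed.

(** The minimum is at least r (p + 1 - r) / (p + 1), and the products r (p + 1 - r) sum to p (p + 1)
    (p + 2) / 6. *)
Lemma sum_min_iota p :
  p ^ 2 <= 6 * \sum_(r <- iota 1 p) minn r (p.+1 - r).
Proof.
(* Partial sums with [p] fixed allow the induction; at q = p the two sides leave the factor 3p + 2 -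
   2p = p + 2. *)
have formula q : q <= p ->
    6 * (\sum_(r <- iota 1 q) r * (p.+1 - r)) + 2 * q ^ 2 * q.+1
    = q * q.+1 * (3 * p + 2).
  elim: q => [|q IHq] qp; first by rewrite big_nil.
  have -> : iota 1 q.+1 = iota 1 q ++ [:: q.+1] by rewrite -[X in iota _ X]addn1 iotaD.
  rewrite big_cat big_seq1 /= mulnDr subSS; have := IHq (ltnW qp).
  have [d ->] : exists d, p = q + d by exists (p - q); rewrite subnKC // ltnW.
  rewrite addKn !expnS !expn0 !muln1.
  by move: (\sum_(_ <- _) _) => Z; lia.
have le_sum : \sum_(r <- iota 1 p) r * (p.+1 - r)
    <= p.+1 * \sum_(r <- iota 1 p) minn r (p.+1 - r).
  rewrite big_distrr /= !big_seq; apply: leq_sum => r.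
  rewrite mem_iota => rp; rewrite /minn; case: ltnP => _.
    by rewrite mulnC leq_mul2r; lia.
  by rewrite leq_mul2r; lia.
have := formula p (leqnn p).
move: le_sum; move: (\sum_(_ <- _) _) (\sum_(_ <- _) _) => Z1 Z2 H1 H2.
have : p.+1 * (p * (p + 2)) <= p.+1 * (6 * Z2) by nia.
by rewrite leq_mul2l /=; nia.
Qed.

(** The ranks are 1, ..., p, each taken once, and an element of rank r has gain min(r, p + 1 - r).
    Dividing by p shows that a uniform choice gains p/6 on average. *)
Lemma sum_pick_gain :
  #|A| ^ 2 <= 6 * \sum_(s in A) pick_gain (fun x y => f x <= f y) A s.
Proof.
apply: leq_trans (sum_min_iota #|A|) _; rewrite leq_mul2l /=.
rewrite -(perm_big _ rank_perm) /= big_map big_enum /=.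
by apply: leq_sum => s sA; rewrite /pick_gain rank_compl.
Qed.

End Rank.

(** * Related pairs of arcs *)

Section Related.
Variables (n : nat) (arcs : seq (darc n)).
Implicit Types (E : seq (darc n)) (L : seq (darc n * darc n)).

Let arc2 : finType := (('I_n * 'I_n) * ('I_n * 'I_n))%type.

(** The pairs range over all arcs ever added, and [E] affects only reachability, so the set grows
    with [E] inside a fixed square. *)
Definition related E : {set arc2} :=
  [set p : arc2 | [&& p.1 \in arcs, p.2 \in arcs & connect (arc_rel E) p.1.2 p.2.1]].

Lemma card_related E : #|related E| <= size arcs ^ 2.
Proof.
rewrite expnS expn1 -(size_allpairs (@pair (darc n) (darc n))).
apply: leq_trans (card_size _); apply/subset_leq_card/subsetP => -[x y].
by rewrite inE => /and3P[/= xa ya _]; apply: allpairs_f.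
Qed.

Lemma related_subseq E E' : {subset E <= E'} -> related E \subset related E'.
Proof.
move=> sEE'; apply/subsetP => p; rewrite !inE => /and3P[-> ->].
exact: connect_subseq.
Qed.

Lemma crossing_pairs (alpha beta : darc n -> nat) L :
  (forall p, p \in L -> alpha p.1 < beta p.2) ->
  size L ^ 2 <=
  (\sum_(p <- L) \sum_(q <- L) (alpha q.1 < beta p.2)).*2.
Proof.
move=> ab; rewrite -addnn {2}exchange_big /= -big_split /=.
have -> : size L ^ 2 = \sum_(p <- L) \sum_(q <- L) 1.
  rewrite -mulnn -{1}(sum1_size L) big_distrl /=; apply: eq_bigr => p _.
  by rewrite mul1n sum1_size.
rewrite [X in _ <= X]big_seq [X in X <= _]big_seq; apply: leq_sum => p pL.
rewrite -big_split /= [X in _ <= X]big_seq [X in X <= _]big_seq.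
apply: leq_sum => q qL; have h1 := ab p pL; have h2 := ab q qL.
case: (ltnP (alpha q.1) (beta p.2)) => // h3.
case: (ltnP (alpha p.1) (beta q.2)) => // h4.
(* If both comparisons failed, then beta p <= alpha q < beta q <= alpha p < beta p. *)
by have := leq_trans (leq_ltn_trans h3 h2) (leq_trans h4 (ltnW h1)); rewrite ltnn.
Qed.

Lemma related_gain G a E S L :
  search_inv G a E S L -> {subset a :: E <= arcs} ->
  size L ^ 2 + (#|related E|).*2 <= (#|related (a :: E)|).*2.
Proof.
move=> iS sE; have wfG := sv_wf iS.
set alpha := fun b : darc n => pos G (rep G b.1).
set beta := fun b : darc n => pos G (rep G b.2).
have sq := @crossing_pairs alpha beta L (sv_pairs iS).
set D := [seq p : arc2 <- [seq (b, c) | b <- unzip2 L, c <- unzip1 L]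
         | alpha p.2 < beta p.1].
have sD : size D = \sum_(p <- L) \sum_(q <- L) (alpha q.1 < beta p.2).
  rewrite size_filter -sum1_count big_mkcond big_allpairs /= big_map.
  apply: eq_bigr => p _; rewrite big_map; apply: eq_bigr => q _.
  by case: ifP.
have uD : uniq D.
  apply/filter_uniq/allpairs_uniq.
  - exact: side_uniq (sv_b iS).
  - exact: side_uniq (sv_f iS).
  - by move=> [? ?] [? ?].
(* A path of old arcs never goes down in the order, whereas these pairs would require one that
   does. *)
have dis : [disjoint D & related E].
  apply/pred0P => -[b c] /=; rewrite mem_filter inE /=; apply/negP.
  case/andP => /andP[lt_cb _] /and3P[_ _ /(sorted_arcs_connect (sv_sorted iS))].
  by rewrite leqNgt -/(alpha c) -/(beta b) lt_cb.
have subD : {subset D <= related (a :: E)}.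
  move=> [b c]; rewrite mem_filter => /andP[_ /allpairsP[[b' c'] /= [bL cL [-> ->]]]].
  have [bE bB _ _] := side_tr (sv_b iS) bL.
  have [cE cF _ _] := side_tr (sv_f iS) cL.
  rewrite inE /= !sE //=.
  apply: (@connect_trans _ _ (rep G b'.2)).
    by apply: (wf_connect wfG); rewrite (wf_rep wfG).
  apply: connect_trans (side_conn (sv_b iS) bB) _.
  apply: (@connect_trans _ _ a.1).
    by apply: (wf_connect wfG); rewrite (wf_rep wfG).
  apply: (@connect_trans _ _ a.2).
    by apply: connect1; rewrite /arc_rel -surjective_pairing mem_head.
  apply: (@connect_trans _ _ (rep G a.2)).
    by apply: (wf_connect wfG); rewrite (wf_rep wfG).
  apply: connect_trans (side_conn (sv_f iS) cF) _.
  by apply: (wf_connect wfG); rewrite (wf_rep wfG).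
have card_D : #|[set p in D]| = size D by rewrite cardsE; apply/card_uniqP.
have sub : [set p in D] :|: related E \subset related (a :: E).
  apply/subsetP => p; rewrite in_setU => /orP[|].
    by rewrite inE; apply: subD.
  by apply/subsetP/related_subseq => b bE; rewrite inE bE orbT.
have := subset_leq_card sub; rewrite cardsU card_D.
have -> : [set p in D] :&: related E = set0.
  apply/setP => p; rewrite in_setI !in_set0 inE; apply: negbTE; apply/negP.
  by case/andP => pD pE; move/pred0P: dis => /(_ p) /=; rewrite pD pE.
rewrite cards0 subn0 sD => le_card; apply: leq_trans (leq_add sq (leqnn _)) _.
by rewrite -doubleD leq_double.
Qed.

End Related.

(** * Total time *)

Import Order.TTheory.

Section Time.
Variables (R : rcfType) (n : nat) (arcs : seq (darc n)) (K : nat).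
Hypothesis uniq_arcs : uniq arcs.
Implicit Types (G : state n) (a : darc n) (S : search n) (p E : seq (darc n)).
Implicit Types (L : seq (darc n * darc n)) (c : config n) (P : R).

Local Open Scope ring_scope.

Let q : R := Num.sqrt (size arcs)%:R.
(** A traversal is charged [4 * K + 6] for the rise of [search_phi], 3 for the pass and its two
    tests, and 12 for its share of the update. In [W], [2 * K + 18] is [2 * K + 6] for the initial
    [search_phi], 1 for the insertion and 11 for the update; [D * q] is the share of a search in the
    AM-GM bound. *)
Let D : R := (4 * K + 21)%:R.
Let W : R := (2 * K + 18)%:R + D * q.

Definition budget E p : R :=
  (size p)%:R * W + D / q * (((size arcs) ^ 2)%:R - #|related arcs E|%:R).

Definition potential E p L : R :=
  budget E p + D * q + 11 - (4 * K + 9)%:R * (size L)%:R.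

(** The 3 units of an active vertex pay for the pass that makes it passive and the two tests that
    follow. The factor [K] scales the gain of a choice so that it covers the cost of the choice. *)
Definition search_phi G S : nat :=
  (K * (phi (before G) (thr S) (factive S) (fpassive S)
      + phi (fun x y => before G y x) (thr S) (bactive S) (bpassive S))
   + 3 * (#|factive S| + #|bactive S|))%N.

Definition searching G a p S (N : nat) P : Prop := exists E L,
  [/\ search_inv G a E S L, perm_eq (a :: E ++ p) arcs &
      potential E p L + N%:R <= P].

(** An invariant under which [P] bounds the time still to be used. The additional 2 and 1 pay for
    pending tests; at a choice the old threshold no longer matters, so vertices are counted without
    [phi]. *)
Definition bounded c P : Prop :=
  match c with
  | Start o p => [/\ p = arcs, perm_eq o (enum 'I_n) &
                     n%:R + budget [::] arcs <= P]
  | Idle G p => exists E, [/\ wf G E, sorted_arcs G E,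
                              perm_eq (E ++ p) arcs & budget E p <= P]
  | Loop G a p T =>
      [/\ factive T = set0 -> fpassive T = set0,
          bactive T = set0 -> bpassive T = set0 &
          searching G a p T (search_phi G T) P]
  | TestF G a p T => searching G a p T (search_phi G T + 2) P
  | PickF G a p T =>
      [/\ factive T = set0, bpassive T = set0 &
          searching G a p T
            (K * (#|fpassive T| + #|bactive T|) + 3 * #|bactive T| + 1) P]
  | TestB G a p T =>
      (factive T = set0 -> fpassive T = set0) /\
      searching G a p T (search_phi G T + 1) P
  | PickB G a p T =>
      [/\ bactive T = set0, fpassive T = set0 &
          searching G a p T
            (K * (#|bpassive T| + #|factive T|) + 3 * #|factive T|) P]
  end.

Let D_ge0 : 0 <= D. Proof. exact: ler0n. Qed.
Let q_ge0 : 0 <= q. Proof. exact: sqrtr_ge0. Qed.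
Let W_ge0 : 0 <= W. Proof. by rewrite addr_ge0 ?ler0n ?mulr_ge0. Qed.

Lemma budget_le E E' p : {subset E <= E'} -> budget E' p <= budget E p.
Proof.
move=> sE; rewrite lerD2l ler_wpM2l ?divr_ge0 // lerD2l lerN2 ler_nat.
exact/subset_leq_card/related_subseq.
Qed.

Lemma budget_ge0 E p : 0 <= budget E p.
Proof.
apply: addr_ge0; first by rewrite mulr_ge0.
by apply: mulr_ge0; rewrite ?divr_ge0 // subr_ge0 ler_nat card_related.
Qed.

Lemma budget_cons E a p : budget E (a :: p) = budget E p + W.
Proof. by rewrite /budget /= -natr1; ring. Qed.

(* The k traversals of a search are paid by AM-GM: the search relates at
   least k^2 / 2 new pairs of arcs, and [k <= q + (k^2 / 2) / q]. *)
Lemma search_paid G a E p S L :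
  search_inv G a E S L -> perm_eq (a :: E ++ p) arcs ->
  budget (a :: E) p + 12 * (size L)%:R + 11 <= potential E p L.
Proof.
move=> iS pE; have sE : {subset a :: E <= arcs}.
  move=> b bE; rewrite -(perm_mem pE) -cat_cons mem_cat bE //.
have := related_gain iS sE; set r0 := #|related arcs E|.
set r1 := #|related arcs (a :: E)| => gain.
have q_gt0 : 0 < q.
  by rewrite sqrtr_gt0 ltr0n -(perm_size pE).
set k : R := (size L)%:R.
have {}gain : k ^+ 2 + 2 * r0%:R <= 2 * r1%:R.
  by move: gain; rewrite -!muln2 -(ler_nat R) natrD natrX !natrM !(mulrC _ 2).
have : D * k <= D * q + D / q * (r1%:R - r0%:R).
  rewrite -mulrA -mulrDr ler_wpM2l //.
  have -> : q + q^-1 * (r1%:R - r0%:R) = (q ^+ 2 + (r1%:R - r0%:R)) / q.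
    by field; rewrite gt_eqF.
  rewrite ler_pdivlMr //.
  have := sqr_ge0 (k - q); have := sqr_ge0 q; nra.
rewrite /potential /budget -/r0 -/r1 -/k /D !natrD !natrM.
set X := _ / q; set Y := q; lra.
Qed.

Lemma searching_ge0 G a p S N P : searching G a p S N P -> 0 <= P.
Proof.
case=> E [L [iS pE le_P]]; apply: le_trans le_P.
apply: addr_ge0 => //; apply: le_trans _ (search_paid iS pE).
by apply: addr_ge0 => //; apply: addr_ge0; [exact: budget_ge0|exact: mulr_ge0].
Qed.

(** Executions may stop anywhere, so the credit must be nonnegative even within a search, where
    [search_paid] ensures it. *)
Lemma bounded_ge0 c P : bounded c P -> 0 <= P.
Proof.
case: c => [o p|G p|G a p S|G a p S|G a p S|G a p S|G a p S] /=.
- by case=> _ _; apply: le_trans; rewrite addr_ge0 ?budget_ge0 ?ler0n.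
- by case=> E [_ _ _]; apply: le_trans; apply: budget_ge0.
- by case=> _ _; apply: searching_ge0.
- exact: searching_ge0.
- by case=> _ _; apply: searching_ge0.
- by case=> _; apply: searching_ge0.
- by case=> _ _; apply: searching_ge0.
Qed.

Lemma searching_move G a p S S' (N N' : nat) P P' :
  (forall E L, search_inv G a E S L -> search_inv G a E S' L) ->
  N'%:R + P <= N%:R + P' -> searching G a p S N P -> searching G a p S' N' P'.
Proof.
move=> SS' le_P [E [L [iS pE le_pot]]]; exists E, L; split=> //; first exact: SS'.
by move: le_P le_pot; move: (potential _ _ _) => Q; lra.
Qed.

Lemma searching_spend G a p S S' (N N' k : nat) P :
  (forall E L, search_inv G a E S L -> search_inv G a E S' L) ->
  (N' + k <= N)%N -> searching G a p S N P ->
  searching G a p S' N' (P - k%:R).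
Proof.
move=> SS' le_N; apply: searching_move => //.
by move: le_N; rewrite -(ler_nat R) natrD; lra.
Qed.

Lemma before_asym G x y : before G x y -> ~~ before G y x.
Proof. by rewrite /before -leqNgt => /ltnW. Qed.

Lemma before_eqE G x y : before_eq G x y = ~~ before G y x.
Proof. by rewrite /before -leqNgt. Qed.

Lemma before_total G a E S L x y : search_inv G a E S L ->
  rep G x = x -> rep G y = y -> x != y -> before G x y || before G y x.
Proof.
move=> iS rx ry; apply: contraNT; rewrite negb_or /before -!leqNgt -eqn_leq => /eqP e.
by apply/eqP; apply: (pos_inj (sv_wf iS) rx ry); rewrite /pos e.
Qed.

Lemma make_passive_inv G a E S L u z : search_inv G a E S L ->
  u \in factive S -> z \in bactive S ->
  search_inv G a E (make_passive G S u z) L.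
Proof.
move=> iS uA zA; apply: search_inv_reclassify (iS) _ _ _ _ _ _ _ _ _ _.
- case: ifP => _; last exact: subsetUl.
  exact: subset_trans (subD1set _ _) (subsetUl _ _).
- case: ifP => _; last exact: subsetUr.
  by rewrite subUset sub1set inE uA subsetUr.
- case: ifP => _; last exact: subsetUl.
  exact: subset_trans (subD1set _ _) (subsetUl _ _).
- case: ifP => _; last exact: subsetUr.
  by rewrite subUset sub1set inE zA subsetUr.
- have dF := side_disj (sv_f iS); case: ifP => _ x; last exact: dF.
  by rewrite !inE negb_or => /andP[-> /dF].
- have dB := side_disj (sv_b iS); case: ifP => _ x; last exact: dB.
  by rewrite !inE negb_or => /andP[-> /dB].
- exact: sv_thr iS.
- move=> x; case: ifP => [su|_]; last exact: (sv_fpas iS).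
  by case/setU1P => [->//|]; apply: (sv_fpas iS).
- move=> x; case: ifP => [zs|_]; last exact: (sv_bpas iS).
  by case/setU1P => [->//|]; apply: (sv_bpas iS).
move=> x y xA yA _; split.
- by move: xA; case: ifP => _; rewrite !inE //; case: eqP => //= ->; rewrite orbT.
- by move: yA; case: ifP => _; rewrite !inE //; case: eqP => //= ->; rewrite orbT.
Qed.

Lemma weighted_le (x x' y y' z z' : nat) :
  (x' <= x -> y' <= y -> z' + 1 <= z ->
   K * (x' + y') + 3 * z' + 3 <= K * (x + y) + 3 * z)%N.
Proof.
move=> hx hy hz; rewrite -addnA leq_add //; first by rewrite leq_mul ?leq_add.
by rewrite -[X in (_ + X <= _)%N](muln1 3) -mulnDr leq_mul.
Qed.

(** A pass without traversal makes some vertex passive: otherwise u <= s <= z <= u, and u = z = s is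
    not admissible. *)
Lemma make_passive_phi G a E S L u z : search_inv G a E S L ->
  admissible S u z -> ~~ before G u z ->
  (search_phi G (make_passive G S u z) + 3 <= search_phi G S)%N.
Proof.
move=> iS /and3P[uA zA nuz]; rewrite -before_eqE => zu.
have ru : rep G u = u.
  by have [uF _] := side_act (sv_f iS) uA; apply: side_rep (sv_f iS) _ uF.
have rz : rep G z = z.
  by have [zB _] := side_act (sv_b iS) zA; apply: side_rep (sv_b iS) _ zB.
have rs := sv_thr iS.
have moved : before G (thr S) u || before G z (thr S).
  apply: contraNT nuz; rewrite negb_or -!before_eqE => /andP[us sz].
  have eq_us : pos G u = pos G (thr S).
    by apply/eqP; rewrite eqn_leq; apply/andP; split; [exact: us|exact: leq_trans sz zu].
  have eq_zs : pos G z = pos G (thr S).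
    by apply/eqP; rewrite eqn_leq; apply/andP; split; [exact: leq_trans zu us|exact: sz].
  by rewrite (pos_inj (sv_wf iS) ru rs eq_us) (pos_inj (sv_wf iS) rz rs eq_zs) eqxx.
have cF : #|factive S| = (#|factive S :\ u|).+1 by rewrite (cardsD1 u) uA.
have cB : #|bactive S| = (#|bactive S :\ z|).+1 by rewrite (cardsD1 z) zA.
have phF (su : before G (thr S) u) := phi_passive (fpassive S) uA su.
have phB (zs : before G z (thr S)) :=
  @phi_passive _ (fun x y => before G y x) _ _ (bpassive S) _ zA zs.
rewrite /search_phi /make_passive /=; move: moved phF phB.
case: (before G (thr S) u) => /=; case: (before G z (thr S)) => //= _.
- move=> /(_ isT) h1 /(_ isT) h2; apply: weighted_le => //.
  by rewrite cF cB addn1 addSn ltnS addnS.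
- by move=> /(_ isT) h1 _; apply: weighted_le => //; rewrite cF addn1 addSn.
- by move=> _ /(_ isT) h2; apply: weighted_le => //; rewrite cB addn1 addnS.
Qed.

(** All forward vertices still held are passive, hence after the threshold. A backward vertex after
    one of them is neither passive nor the threshold, so it is kept. *)
Lemma fwd_empty_inv G a E S L : factive S = set0 ->
  search_inv G a E S L -> search_inv G a E (fwd_empty S) L.
Proof.
move=> F0 iS; apply: search_inv_reclassify (iS) _ _ _ _ _ _ _ _ _ _.
- exact: subsetUl.
- exact: subsetUr.
- exact: subset_trans (subD1set _ _) (subsetUl _ _).
- exact: sub0set.
- exact: side_disj (sv_f iS).
- by move=> x _; rewrite inE.
- exact: sv_thr iS.
- exact: sv_fpas iS.
- by move=> x; rewrite inE.
move=> x y xA yA xy; split=> //.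
have sy : before G (thr S) y.
  by move: xA; rewrite F0 set0U => /(sv_fpas iS) sx; exact: ltn_trans sx xy.
move: yA; rewrite !inE orbF => /orP[->|/(sv_bpas iS)]; last first.
  by move/before_asym; rewrite sy.
by rewrite andbT; apply: contraTneq sy => ->; rewrite /before ltnn.
Qed.

Lemma bwd_empty_inv G a E S L : bactive S = set0 ->
  search_inv G a E S L -> search_inv G a E (bwd_empty S) L.
Proof.
move=> B0 iS; apply: search_inv_reclassify (iS) _ _ _ _ _ _ _ _ _ _.
- exact: subset_trans (subD1set _ _) (subsetUl _ _).
- exact: sub0set.
- exact: subsetUl.
- exact: subsetUr.
- by move=> x _; rewrite inE.
- exact: side_disj (sv_b iS).
- exact: sv_thr iS.
- by move=> x; rewrite inE.
- exact: sv_bpas iS.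
move=> x y xA yA xy; split=> //.
have xs : before G x (thr S).
  by move: yA; rewrite B0 set0U => /(sv_bpas iS) ys; exact: ltn_trans xy ys.
move: xA; rewrite !inE orbF => /orP[->|/(sv_fpas iS)]; last first.
  by move/before_asym; rewrite xs.
by rewrite andbT; apply: contraTneq xs => ->; rewrite /before ltnn.
Qed.

Lemma fwd_threshold_inv G a E S L s : factive S = set0 -> bpassive S = set0 ->
  s \in fpassive S ->
  search_inv G a E S L -> search_inv G a E (fwd_threshold G S s) L.
Proof.
move=> F0 B0 sP iS; apply: search_inv_reclassify (iS) _ _ _ _ _ _ _ _ _ _.
- by apply/subsetP => x; rewrite !inE => /andP[->]; rewrite orbT.
- by apply/subsetP => x; rewrite !inE => /andP[->]; rewrite orbT.
- exact: subsetUl.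
- exact: subsetUr.
- by move=> x; rewrite !inE => /andP[-> ->].
- exact: side_disj (sv_b iS).
- by have [sF _] := side_pas (sv_f iS) sP; apply: side_rep (sv_f iS) _ sF.
- by move=> x; rewrite inE before_eqE negbK => /andP[].
- by move=> x; rewrite B0 inE.
move=> x y xA yA _; split=> //.
by move: xA; rewrite F0 set0U => xP; rewrite !inE xP orbN.
Qed.

Lemma bwd_threshold_inv G a E S L s : bactive S = set0 -> fpassive S = set0 ->
  s \in bpassive S ->
  search_inv G a E S L -> search_inv G a E (bwd_threshold G S s) L.
Proof.
move=> B0 F0 sP iS; apply: search_inv_reclassify (iS) _ _ _ _ _ _ _ _ _ _.
- exact: subsetUl.
- exact: subsetUr.
- by apply/subsetP => x; rewrite !inE => /andP[->]; rewrite orbT.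
- by apply/subsetP => x; rewrite !inE => /andP[->]; rewrite orbT.
- exact: side_disj (sv_f iS).
- by move=> x; rewrite !inE => /andP[-> ->].
- by have [sB _] := side_pas (sv_b iS) sP; apply: side_rep (sv_b iS) _ sB.
- by move=> x; rewrite F0 inE.
- by move=> x; rewrite inE before_eqE negbK => /andP[].
move=> x y xA yA _; split=> //.
by move: yA; rewrite B0 set0U => yP; rewrite !inE yP orbN.
Qed.

Lemma next_arc E a p : perm_eq (E ++ a :: p) arcs ->
  perm_eq (a :: E ++ p) arcs /\ a \notin E.
Proof.
move=> pE; have pE' : perm_eq (a :: E ++ p) arcs.
  by apply: perm_trans pE; rewrite perm_sym -cat1s perm_catCA.
split=> //; have := perm_uniq pE'; rewrite uniq_arcs => /andP[+ _].
by rewrite mem_cat negb_or => /andP[].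
Qed.

Lemma insert_sorted G E a i j : sorted_arcs G E ->
  ~~ before G (rep G a.2) (rep G a.1) -> sorted_arcs (insert_arc G a i j) (a :: E).
Proof.
by move=> sG nb b; rewrite inE => /orP[/eqP->|/sG//]; move: nb; rewrite -leqNgt.
Qed.

Lemma init_search_phi G a : (search_phi G (init_search G a) <= K * 2 + 6)%N.
Proof.
rewrite /search_phi /=; set A := if _ then _ else _; set B := if _ then _ else _.
have cA : (#|A| <= 1)%N by rewrite /A; case: ifP; rewrite ?cards0 ?cards1.
have cB : (#|B| <= 1)%N by rewrite /B; case: ifP; rewrite ?cards0 ?cards1.
have phA := phi_le_card (@before_asym G) (rep G a.1) A.
have phB := phi_le_card (fun x y => @before_asym G y x) (rep G a.1) B.
apply: (@leq_add _ _ _ 6).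
  by rewrite leq_mul // -[2%N]/(1 + 1)%N leq_add // ?(leq_trans phA) ?(leq_trans phB).
by rewrite -[6%N]/(3 * (1 + 1))%N leq_mul // leq_add.
Qed.

Lemma traversal_weight (x y f b x' y' f' b' : nat) :
  (x' <= x + 2 -> y' <= y + 2 -> f' <= f + 1 -> b' <= b + 1 ->
   K * (x' + y') + 3 * (f' + b') <= K * (x + y) + 3 * (f + b) + (4 * K + 6))%N.
Proof.
move=> hx hy hf hb; have := leq_mul (leqnn K) (leq_add hx hy).
by rewrite !mulnDr; lia.
Qed.

Lemma loop_body_bounded G a p S u z P :
  admissible S u z -> bounded (Loop G a p S) P ->
  let GS := loop_body G S u z in bounded (TestF GS.1 a p GS.2) (P - 1).
Proof.
move=> adm [_ _ [E [L [iS pE le_P]]]]; have [uA zA _] := and3P adm.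
rewrite /loop_body; case: ifP => [uz|/negbT nuz] /=.
  have [b [iS' [x [y [[er et] [sF sB eFP eBP eT]]]]]] := search_step_inv iS uA zA uz.
  exists E, (b :: L); split=> //; move: iS' sF sB eFP eBP eT er et.
  move: (search_step _ _ _ _) => GS iS' sF sB eFP eBP eT er et.
  have eb : before GS.1 = before G by rewrite /before et.
  have cF := subset_leq_card sF; have cB := subset_leq_card sB.
  have {}cF : (#|factive GS.2| <= #|factive S| + 1)%N.
    by apply: leq_trans cF _; rewrite cardsU1 addnC leq_add2l leq_b1.
  have {}cB : (#|bactive GS.2| <= #|bactive S| + 1)%N.
    by apply: leq_trans cB _; rewrite cardsU1 addnC leq_add2l leq_b1.
  have phF := @phi_le _ (before G) (thr S) _ _ (fpassive S) _ sF.
  have phB := @phi_le _ (fun x y => before G y x) (thr S) _ _ (bpassive S) _ sB.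
  have le_phi : (search_phi GS.1 GS.2 <= search_phi G S + (4 * K + 6))%N.
    rewrite /search_phi eFP eBP eT eb.
    exact: traversal_weight.
  move: le_phi le_P; rewrite -(ler_nat R) /potential /= -[(size L).+1%:R]natr1 !natrD !natrM.
  by move: (budget _ _) (size L)%:R => X Y; lra.
exists E, L; split=> //; first exact: make_passive_inv.
have := make_passive_phi iS adm nuz; move: le_P.
move: (potential _ _ _) (search_phi _ _) (search_phi _ _) => X N N' le_P.
by rewrite -(ler_nat R) !natrD; lra.
Qed.

Lemma emptyF_bounded G a p S P : factive S = set0 ->
  bounded (TestF G a p S) P ->
  bounded (if fpassive S == set0 then TestB G a p (fwd_empty S)
           else PickF G a p (fwd_empty S)) (P - 1).
Proof.
move=> F0 bS; have inv E L := @fwd_empty_inv G a E S L F0.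
have cB : (#|bactive S :\ thr S| <= #|bactive S|)%N.
  by rewrite subset_leq_card ?subD1set.
case: ifP => [/eqP FP0|_] /=.
  split=> //; apply: (searching_spend (k := 1)) inv _ bS.
  rewrite /search_phi /= -addnA leq_add2r leq_add //; last first.
    by rewrite leq_mul // leq_add.
  by rewrite leq_mul // leq_add // phi_clear.
split=> //; have [E [L [iS _ _]]] := bS.
apply: (searching_spend (k := 1)) inv _ bS.
rewrite /search_phi /= F0 phi_set0 cards0 add0n -addnA leq_add2r leq_add //.
  rewrite leq_mul // leq_add2l phi_drop // => x xA ne.
  have [xB _] := side_act (sv_b iS) xA; rewrite orbC.
  exact: before_total iS (side_rep (sv_b iS) xB) (sv_thr iS) ne.
by rewrite leq_mul.
Qed.

Lemma emptyB_bounded G a p S P : bactive S = set0 ->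
  bounded (TestB G a p S) P ->
  bounded (if bpassive S == set0 then Loop G a p (bwd_empty S)
           else PickB G a p (bwd_empty S)) (P - 1).
Proof.
move=> B0 [_ bS]; have inv E L := @bwd_empty_inv G a E S L B0.
have cF : (#|factive S :\ thr S| <= #|factive S|)%N.
  by rewrite subset_leq_card ?subD1set.
case: ifP => [/eqP BP0|_] /=.
  split=> //; apply: (searching_spend (k := 1)) inv _ bS.
  rewrite /search_phi /= leq_add2r leq_add //; last first.
    by rewrite leq_mul // leq_add.
  by rewrite leq_mul // leq_add // phi_clear.
split=> //; have [E [L [iS _ _]]] := bS.
apply: (searching_spend (k := 1)) inv _ bS.
rewrite /search_phi /= B0 phi_set0 cards0 addn0 leq_add2r leq_add //.
  rewrite leq_mul // addnC leq_add2r phi_drop // => x xA ne.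
  have [xF _] := side_act (sv_f iS) xA.
  exact: before_total iS (side_rep (sv_f iS) xF) (sv_thr iS) ne.
by rewrite leq_mul.
Qed.

Lemma step_bounded c k c' P : step c k c' -> bounded c P -> bounded c' (P - k%:R).
Proof.
case.
- move=> o p [-> po le_P]; exists [::]; split=> //; first exact: wf_init.
  by move: le_P; move: (budget _ _) => X; lra.
- move=> G a p i j nb [E [wfG sG pE le_P]].
  have [pE' aE] := next_arc pE; exists (a :: E); split=> //.
  + exact: wf_insert.
  + exact: insert_sorted.
  have : budget (a :: E) p <= budget E p.
    by apply: budget_le => b bE; rewrite inE bE orbT.
  have : 1 <= W.
    have : 0 <= D * q by rewrite mulr_ge0.
    by rewrite /W natrD natrM; have : 0 <= K%:R :> R; [exact: ler0n|lra].
  move: le_P; rewrite budget_cons.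
  by move: (budget _ _) (budget _ _) => X Y; lra.
- move=> G a p i j nb /= [E [wfG sG pE le_P]].
  have [pE' aE] := next_arc pE; split=> //.
  exists E, [::]; split=> //.
    by apply: search_inv_init => //; apply: wf_insert.
  have := init_search_phi (insert_arc G a i j) a; move: (search_phi _ _) => N.
  rewrite -(ler_nat R); move: le_P.
  rewrite budget_cons /potential /W /= mulr0 !natrD !natrM.
  by move: (budget _ _) (D * q) N%:R => X Y Z; lra.
- by move=> G a p S u z adm GS; apply: loop_body_bounded.
- move=> G a p S F0 bS; split=> [e|]; first by rewrite e eqxx in F0.
  by apply: searching_spend bS => //; rewrite -addnA.
- by move=> G a p S F0; apply: emptyF_bounded.
- move=> G a p S B0 [hF bS]; split=> // [e|]; first by rewrite e eqxx in B0.
  exact: searching_spend bS.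
- by move=> G a p S B0; apply: emptyB_bounded.
move=> G a p S lF lB ko ki na tF tB pko pki [hF hB [E [L [iS pE le_P]]]].
have done_S := no_admissible_done iS hF hB na.
exists (a :: E); split=> //.
- exact: (new_state_wf iS tF tB pko pki).
- exact: (new_state_sorted iS done_S tF tB pko pki).
have := update_time_le iS done_S; have := search_paid iS pE.
rewrite -(ler_nat R) natrD natrM; move: le_P.
have : 0 <= (search_phi G S)%:R :> R by exact: ler0n.
move: (budget _ _) (potential _ _ _) (search_phi _ _) => X Y N.
by move: N%:R => Z; lra.
Qed.

Lemma pick_weight (x y g c e f : nat) :
  (x + g <= c -> y <= e -> f <= c ->
   K * (x + y) + 3 * (f + e) + K * g <= K * (c + e) + 3 * e + 3 * c)%N.
Proof.
move=> h1 h2 h3; have := leq_mul (leqnn K) (leq_add h1 h2).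
by rewrite !mulnDr; lia.
Qed.

(** At most |choices| vertices become active again, at 3 units each, against a fall of [K] times the
    gain. The duration of the choice itself is charged by the callers. *)
Lemma pick_bounded c s P : s \in choices c -> bounded c P ->
  bounded (set_threshold c s) (P + 3 * #|choices c|%:R
     - K%:R * (pick_gain (config_le c) (choices c) s)%:R).
Proof.
case: c => [o p|G p|G a p S|G a p S|G a p S|G a p S|G a p S] /=;
  rewrite ?in_set0 // => sP [A0 P0 bS].
- split=> [e|].
    (* The chosen threshold itself becomes active. *)
    suff : s \in set0 by rewrite in_set0.
    by rewrite -e inE sP; exact: leqnn.
  apply: searching_move bS; first by move=> *; apply: fwd_threshold_inv.
  have h1 := phi_pick s (fpassive S) (@before_eqE G).
  have h2 := phi_le_card (fun x y => @before_asym G y x) s (bactive S).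
  have h3 : (#|[set x in fpassive S | before_eq G x s]| <= #|fpassive S|)%N.
    by apply/subset_leq_card/subsetP => x; rewrite inE => /andP[].
  have := pick_weight h1 h2 h3; rewrite /search_phi /= P0 -(ler_nat R).
  move: (K * (_ + _) + 3 * (_ + _))%N (pick_gain _ _ _) => N g.
  by rewrite !natrD !natrM; lra.
- split=> // [e|].
    suff : s \in set0 by rewrite in_set0.
    by rewrite -e inE sP; exact: leqnn.
  apply: searching_move bS; first by move=> *; apply: bwd_threshold_inv.
  have h1 := @phi_pick _ (fun x y => before G y x) (fun x y => before_eq G y x)
    s (bpassive S) (fun x y => before_eqE G y x).
  have h2 := phi_le_card (@before_asym G) s (factive S).
  have h3 : (#|[set x in bpassive S | before_eq G s x]| <= #|bpassive S|)%N.
    by apply/subset_leq_card/subsetP => x; rewrite inE => /andP[].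
  have := pick_weight h1 h2 h3; rewrite /search_phi /= P0 -(ler_nat R).
  rewrite [(phi _ _ _ _ + phi _ _ _ _)%N]addnC [(#|_| + #|factive S|)%N]addnC.
  rewrite {1}/pick_gain minnC -/(pick_gain _ _ _).
  move: (K * (_ + _) + 3 * (_ + _))%N (pick_gain _ _ _) => N g.
  by rewrite !natrD !natrM; lra.
Qed.

(** The factor 4 is 1 for making the choice plus 3 for reactivation. *)
Lemma run_bounded (rule : rel 'I_n -> {set 'I_n} -> 'I_n -> Prop) c T P :
  (forall le A s, rule le A s -> s \in A ->
     4 * #|A| <= K * pick_gain le A s)%N ->
  run rule c T -> bounded c P -> T%:R <= P.
Proof.
move=> ruleK rT; elim: rT P => {c T} [c|c k c' T cc' _ IH|c s T sc rs _ IH] P bP.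
- exact: bounded_ge0 bP.
- by have := IH _ (step_bounded cc' bP); rewrite natrD; lra.
have := IH _ (pick_bounded sc bP); have := ruleK _ _ _ rs sc.
rewrite -(ler_nat R) !natrM natrD; move: (_ * (pick_gain _ _ _)%:R) => X; lra.
Qed.

Lemma pick_gain_sum c P : bounded c P ->
  (#|choices c| ^ 2 <=
   6 * \sum_(s in choices c) pick_gain (config_le c) (choices c) s)%N.
Proof.
case: c => [o p|G p|G a p S|G a p S|G a p S|G a p S|G a p S] /=;
  rewrite ?cards0 //.
- move=> [_ _ [E [L [iS _ _]]]]; apply: (@sum_pick_gain _ (pos G)) => x y xP yP.
  have [xF _] := side_pas (sv_f iS) xP; have [yF _] := side_pas (sv_f iS) yP.
  exact: (pos_inj (sv_wf iS) (side_rep (sv_f iS) xF) (side_rep (sv_f iS) yF)).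
- move=> [_ _ [E [L [iS _ _]]]]; apply: (@sum_pick_gain _ (pos G)) => x y xP yP.
  have [xF _] := side_pas (sv_b iS) xP; have [yF _] := side_pas (sv_b iS) yP.
  exact: (pos_inj (sv_wf iS) (side_rep (sv_b iS) xF) (side_rep (sv_b iS) yF)).
Qed.

(** A choice among p vertices costs 4p and gains p/6 on average, whence the value 24. *)
Lemma expected_bounded c (T P : R) :
  (24 <= K)%N -> expected_run c T -> bounded c P -> T <= P.
Proof.
move=> K24 rT; elim: rT P => {c T} [c|c k c' T cc' _ IH|c T c0 _ IH] P bP.
- exact: bounded_ge0 bP.
- by have := IH _ (step_bounded cc' bP); lra.
have card_gt0 : 0 < #|choices c|%:R :> R by rewrite ltr0n card_gt0.
have le_T s : s \in choices c -> T s <= P + 3 * #|choices c|%:R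
     - 24 * (pick_gain (config_le c) (choices c) s)%:R.
  move=> sc; apply: le_trans (IH s sc _ (pick_bounded sc bP)) _.
  by rewrite lerD2l lerN2 ler_wpM2r // ler_nat.
have := ler_sum (P := fun s => s \in choices c) (index_enum _) le_T.
rewrite sumrB sumr_const -mulr_sumr -natr_sum.
have := pick_gain_sum bP; rewrite -(ler_nat R) natrX natrM.
move: (\sum_(s in _) T s) (\sum_(s in _) _)%N => X Y hY.
rewrite -[_ *+ _]mulr_natr => hX.
suff : X / #|choices c|%:R <= P - #|choices c|%:R by lra.
by rewrite ler_pdivrMr //; move: hX hY; set z := #|_|%:R; nra.
Qed.

(** After bounding q^2 by q^3, the coefficients add up to d + (2K + 18) + 2 (4K + 21). *)
Lemma budget_start (d : nat) : (n <= d * size arcs)%N ->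
  n%:R + budget [::] arcs <= (d + 10 * K + 60)%:R * q ^+ 3.
Proof.
rewrite -(ler_nat R) natrM => le_n.
have q2 : (size arcs)%:R = q ^+ 2 by rewrite sqr_sqrtr.
have q23 : q ^+ 2 <= q ^+ 3.
  have [m0|m_gt0] := posnP (size arcs).
    have q0 : q = 0 by rewrite /q m0 sqrtr0.
    by rewrite q0 !expr0n.
  rewrite [q ^+ 3]exprS ler_peMl ?exprn_ge0 // -sqrtr1 ler_wsqrtr //.
  by rewrite ler1n.
have last_term : D / q * ((size arcs ^ 2)%:R - #|related arcs [::]|%:R) <= D * q ^+ 3.
  apply: (@le_trans _ _ (D / q * (size arcs ^ 2)%:R)).
    by rewrite ler_wpM2l ?divr_ge0 // lerBlDr lerDl.
  rewrite natrX q2 -exprM.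
  (* Without arcs [q] is 0, and its inverse is 0 by convention. *)
  case: (eqVneq q 0) => [->|q0]; first by rewrite invr0 mulr0 mul0r mulr_ge0 // exprn_ge0.
  by rewrite le_eqVlt; apply/orP; left; apply/eqP; field.
move: last_term le_n; rewrite /budget /W q2.
set X := D / q * _ => last_term le_n.
have : D * q * q ^+ 2 = D * q ^+ 3 by rewrite -mulrA -exprS.
have hK : 0 <= K%:R :> R by exact: ler0n.
have hd : 0 <= d%:R :> R by exact: ler0n.
have h1 : d%:R * q ^+ 2 <= d%:R * q ^+ 3 by rewrite ler_wpM2l.
have h2 : K%:R * q ^+ 2 <= K%:R * q ^+ 3 by rewrite ler_wpM2l.
move: last_term; rewrite /D !natrD ?natrM.
move: h1 h2 q23 le_n hK hd; rewrite ?natrD ?natrM; lra.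
Qed.

End Time.

Lemma approx_median_gain n k (le : rel 'I_n) (A : {set 'I_n}) s :
  approx_median k le A s -> 4 * #|A| <= 4 * k * pick_gain le A s.
Proof.
case=> h1 h2; rewrite -mulnA leq_mul2l /= /pick_gain /minn.
by case: ifP.
Qed.

(* "m = Omega(n)" is "n <= c * m"; "m^(3/2)" is "(sqrt m)^3". *)
Theorem theorem6p4 :
  (* each new threshold is a median of the set of choices *)
  (forall c : nat, exists C : nat,
     forall (R : rcfType) (n : nat) (o : seq 'I_n) (arcs : seq (darc n))
            (T : nat),
       perm_eq o (enum 'I_n) -> uniq arcs -> n <= c * size arcs ->
       run (@median n) (Start o arcs) T ->
       (T%:R <= C%:R * Num.sqrt ((size arcs)%:R : R) ^+ 3)%R)
  /\
  (* each new threshold is an approximate median of the set of choices *)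
  (forall c k : nat, exists C : nat,
     forall (R : rcfType) (n : nat) (o : seq 'I_n) (arcs : seq (darc n))
            (T : nat),
       perm_eq o (enum 'I_n) -> uniq arcs -> n <= c * size arcs ->
       run (@approx_median n k) (Start o arcs) T ->
       (T%:R <= C%:R * Num.sqrt ((size arcs)%:R : R) ^+ 3)%R)
  /\
  (* each new threshold is chosen uniformly at random *)
  (forall c : nat, exists C : nat,
     forall (R : rcfType) (n : nat) (o : seq 'I_n) (arcs : seq (darc n))
            (E : R),
       perm_eq o (enum 'I_n) -> uniq arcs -> n <= c * size arcs ->
       expected_run (Start o arcs) E ->
       (E <= C%:R * Num.sqrt ((size arcs)%:R : R) ^+ 3)%R).
Proof.
have median_bound c k : exists C : nat,
    forall (R : rcfType) (n : nat) (o : seq 'I_n) (arcs : seq (darc n)) (T : nat),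
    perm_eq o (enum 'I_n) -> uniq arcs -> n <= c * size arcs ->
    run (@approx_median n k) (Start o arcs) T ->
    (T%:R <= C%:R * Num.sqrt ((size arcs)%:R : R) ^+ 3)%R.
  exists (c + 10 * (4 * k) + 60) => R n o arcs T po ua le_n rT.
  apply: le_trans (budget_start R (4 * k) le_n).
  apply: (run_bounded (K := 4 * k) ua _ rT) => [le A s /approx_median_gain //|].
  by split.
split; [|split] => [c|//|c]; first exact: median_bound.
exists (c + 10 * 24 + 60) => R n o arcs E po ua le_n rE.
apply: le_trans (budget_start R 24 le_n).
by apply: (expected_bounded (K := 24) ua (leqnn _) rE); split.
Qed.
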